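(* Let $0<p\le 1$ and let $\rho<\rho^*(p)$. There exist constants $c_4,c_5>0$ (depending on $p$ and $\rho$) such that whenever $n$ is large enough and $m\ge c_4 n$, with probability at least $1-e^{-c_5 n}$ an $m\times n$ random matrix $A$ with i.i.d. $N(0,1)$ entries has the following property: for every $f\in\mathbf{R}^n$ and every $e\in\mathbf{R}^m$ whose support $T=\{i: e_i\neq 0\}$ satisfies $|T|\le \rho m$, setting $y=Af+e$, the vector $f$ is the unique solution of the minimization problem $\min_{x\in\mathbf{R}^n}\|y-Ax\|_p^p$.
   Context: For a vector $v$ and $p>0$, $\|v\|_p^p:=\sum_i|v_i|^p$. Definition of the threshold $\rho^*(p)$ for $p\in(0,1]$: let $X\sim N(0,1)$, and let $f_{|X|}$ and $F$ denote the probability density function and cumulative distribution function of $|X|$. Let $z^*=z^*(p)\in(0,\infty)$ be the (unique) number with $\int_{z^*}^\infty x^p f_{|X|}(x)\,dx=\frac12\int_0^\infty x^p f_{|X|}(x)\,dx$, and put $\rho^*(p):=1-F(z^* )$. *)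

(* Defs.v *)
(* [all_analysis] does not export [measurable_realfun], which provides the
   measurable structure on [\bar R]. *)
From HB Require Import structures.
From mathcomp Require Export all_boot all_order all_algebra.
From mathcomp Require Export all_classical all_reals all_analysis.
From mathcomp Require Export measurable_realfun.
Export Order.TTheory GRing.Theory Num.Theory.
Export numFieldNormedType.Exports.

Set Implicit Arguments.
Unset Strict Implicit.
Unset Printing Implicit Defensive.

Local Open Scope classical_set_scope.
Local Open Scope ring_scope.

(* The density of |X| for X ~ N(0, 1): on [0, +oo[ it is the sum of the
   standard normal densities at x and at - x (which coincide), and it vanishes
   on ]-oo, 0[. *)
Definition abs_normal_pdf (R : realType) (x : R) : R :=
  if 0 <= x then normal_pdf 0 1 x + normal_pdf 0 1 (- x) else 0.

(* [abs_normal_pdf] is indeed a density of the law of |X|. *)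
Lemma abs_normal_pdfP (R : realType) (B : set R) : measurable B ->
  normal_prob 0 1 [set x : R | B `|x|] =
   (\int[lebesgue_measure]_(x in B) (abs_normal_pdf x)%:E)%E.
Proof.
move=> mB.
pose mu := @lebesgue_measure R.
pose phi (x : R) : \bar R := (normal_pdf 0 1 x)%:E.
have mphi : measurable_fun [set: R] phi.
  by apply/measurable_EFinP; exact: measurable_normal_pdf.
have mphiN : measurable_fun [set: R] (fun x : R => phi (- x)).
  apply: (measurableT_comp mphi); exact: oppr_measurable.
have phi0 x : (0 <= phi x)%E by rewrite lee_fin normal_pdf_ge0.
have mI : measurable_fun [set: R] (fun x : R => (\1_B x)%:E : \bar R).
  by apply/measurable_EFinP; exact: measurable_indic.
have mIN : measurable_fun [set: R] (fun x : R => (\1_B (- x))%:E : \bar R).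
  apply: (measurableT_comp mI); exact: oppr_measurable.
have I0 x : (0 <= (\1_B x)%:E :> \bar R)%E by rewrite lee_fin indicE.
pose g (x : R) : \bar R := ((\1_B `|x|)%:E * phi x)%E.
have mg : measurable_fun [set: R] g.
  apply: emeasurable_funM => //.
  apply: (measurableT_comp mI); exact: normr_measurable.
rewrite /normal_prob integral_mkcond [RHS]integral_mkcond.
transitivity (\int[mu]_x g x)%E.
  apply: eq_integral => x _; rewrite patchE /g indicE /phi.
  have -> : (x \in [set y : R | B `|y|]) = (`|x| \in B) by apply/idP/idP; rewrite !inE.
  by case: (_ \in B); rewrite ?mul1e ?mul0e.
have -> : [set: R] = `[0, +oo[ `|` `]-oo, 0[ by rewrite -setCitvl setvU.
have disj : [disjoint `[(0:R), +oo[%classic & `]-oo, (0:R)[%classic].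
  by rewrite -setCitvl disj_set2E setICl.
rewrite !ge0_integral_setU//=.
- rewrite [X in (_ + X)%E = _]integral_itv_bndo_bndc; last exact/measurable_funTS.
  rewrite [X in _ = (_ + X)%E]integral0_eq ?adde0; last first.
    move=> x; rewrite /= in_itv /= => x0; rewrite patchE /abs_normal_pdf.
    by rewrite leNgt x0 /=; case: ifP.
  have -> : (\int[mu]_(x in `]-oo, 0%R]) g x =
    \int[mu]_(x in `[0%R, +oo[) ((\1_B x)%:E * phi (- x)%R))%E.
    rewrite ge0_integration_by_substitution0; last 2 first.
    - exact: emeasurable_funM.
    - by move=> r; rewrite mule_ge0.
    apply: eq_integral => x; rewrite inE /= in_itv /= => x0.
    by rewrite /g ler0_norm // opprK.
  rewrite -ge0_integralD //=.
  + apply: eq_integral => x; rewrite inE /= in_itv /= andbT => x0.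
    rewrite /g ger0_norm // patchE /abs_normal_pdf x0 indicE /phi.
    by case: (x \in B); rewrite ?mul1e ?mul0e ?adde0.
  + by move=> x _; rewrite mule_ge0.
  + exact/measurable_funTS.
  + by move=> x _; rewrite mule_ge0.
  + by apply/measurable_funTS; exact: emeasurable_funM.
- apply: measurable_funTS; apply/(measurable_restrictT _ mB)/measurable_funTS.
  apply/measurable_EFinP; apply: measurable_fun_ifT => //.
    exact: measurable_fun_ler.
  apply: measurable_funD; first exact: measurable_normal_pdf.
  by apply: measurableT_comp; [exact: measurable_normal_pdf|exact: oppr_measurable].
- move=> x _; rewrite patchE; case: ifP => // _; rewrite lee_fin /abs_normal_pdf.
  by case: ifP => // _; rewrite addr_ge0 ?normal_pdf_ge0.
- exact: measurable_funTS.
- by move=> x _; rewrite mule_ge0.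
Qed.

Definition abs_normal_cdf (R : realType) (z : R) : R :=
  fine (normal_prob 0 1 [set x : R | `|x| <= z]).

Definition is_zstar (R : realType) (p z : R) : Prop :=
  0 < z /\
  (\int[lebesgue_measure]_(x in `[z, +oo[) (x `^ p * abs_normal_pdf x)%:E =
   (2^-1)%:E *
   \int[lebesgue_measure]_(x in `[0%R, +oo[) (x `^ p * abs_normal_pdf x)%:E)%E.

(* [xget 0] selects the point satisfying [is_zstar p]; the default value 0 is
   never used, as that point exists (and is unique) for every p > 0. *)
Definition zstar (R : realType) (p : R) : R := xget 0 [set z | is_zstar p z].

Definition rho_star (R : realType) (p : R) : R := 1 - abs_normal_cdf (zstar p).

(* The p-th power of the l_p (quasi-)norm. *)
Definition normpp (R : realType) (p : R) (k : nat) (v : 'cV[R]_k) : R :=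
  \sum_(i < k) `|v i 0| `^ p.

Definition supp (R : realType) (k : nat) (v : 'cV[R]_k) : {set 'I_k} :=
  [set i | v i 0 != 0]%SET.

Definition is_minimizer (R : realType) (V : Type) (g : V -> R) (x : V) : Prop :=
  forall x' : V, g x <= g x'.

Definition mutually_independent d (Omega : measurableType d) (R : realType)
    (P : probability Omega R) (I : finType) (X : I -> {RV P >-> R}) : Prop :=
  forall (J : {set I}) (B : I -> set R), (forall i, measurable (B i)) ->
    P (\bigcap_(i in [set` J]) (X i @^-1` B i)) =
    (\prod_(i in J) P (X i @^-1` B i))%E.

Definition iid_std_normal d (Omega : measurableType d) (R : realType)
    (P : probability Omega R) (m n : nat)
    (A : 'I_m -> 'I_n -> {RV P >-> R}) : Prop :=
  (forall i j (B : set R), measurable B ->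
     distribution P (A i j) B = normal_prob 0 1 B) /\
  mutually_independent (fun ij : 'I_m * 'I_n => A ij.1 ij.2).

Definition sample_mx d (Omega : measurableType d) (R : realType)
    (P : probability Omega R) (m n : nat)
    (A : 'I_m -> 'I_n -> {RV P >-> R}) (w : Omega) : 'M[R]_(m, n) :=
  \matrix_(i < m, j < n) A i j w.

Definition lp_corrects (R : realType) (p rho : R) (m n : nat)
    (A : 'M[R]_(m, n)) : Prop :=
  forall (f : 'cV[R]_n) (e : 'cV[R]_m), #|supp e|%:R <= rho * m%:R ->
    let y := A *m f + e in
    unique (is_minimizer (fun x : 'cV[R]_n => normpp p (y - A *m x))) f.

(* Main.v *)
Require Import Defs.
From HB Require Import structures.
From mathcomp Require Import ring lra.

(* Write [tau = zstar ^ p] and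
   [psi x = | |x| ^ p - tau | + (2 rho - 1) tau]. For every set [T] of at most
   [rho m] indices and every vector [x] of length [m], the difference
   [sum_(i in T) |x_i| ^ p - sum_(i notin T) |x_i| ^ p] is at most
   [sum_i psi x_i], so [f] is the unique minimizer as soon as
   [sum_i psi ((A z)_i) < 0] for every unit vector [z]. For a fixed [z] the
   entries of [A z] are i.i.d. standard normal, and the choice of [zstar] gives
   [E psi = 2 (rho - rho_star) tau < 0]; a Chernoff bound makes the sum at most
   [- del m] outside an event of probability [theta ^ m] with [theta < 1].
   Since [|psi x - psi y| <= |x - y| ^ p], a union bound over a net of [D ^ n]
   unit vectors extends this to the whole sphere; the error term
   [sum_i |(A (z - v))_i| ^ p] is controlled by the supremum over the sphere,
   itself bounded in terms of the net. *)

Set Implicit Arguments.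
Unset Strict Implicit.
Unset Printing Implicit Defensive.

Local Open Scope classical_set_scope.
Local Open Scope ring_scope.

(** * Gaussian laws *)

(** The obstacle is uniformity over the supports: a union bound over all sets [T] would cost a
    factor exponential in [m], which cannot be absorbed near the threshold. The function [psi]
    removes [T] altogether: with [u = |x_i| ^ p] one has [u <= |u - tau| + tau] and
    [- u <= |u - tau| - tau], and the terms [tau] and [- tau] add up to
    [(2 |T| - m) tau <= (2 rho - 1) m tau]. Any level [tau >= 0] would do here; at [zstar ^ p],
    where half of the [p]-th moment lies in the tail, that moment cancels from the mean of
    [|u - tau|] and only the tail probability [rho_star] is left. As [p <= 1], [psi] grows at most
    linearly, so it has exponential moments and the rate [theta] depends on [p] and [rho] only. The
    thresholds in the net argument are all proportional to [m], so the radius of the net, and with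
    it [D], depends on neither [m] nor [n]. The total failure probability [2 D ^ n theta ^ m] is
    then small once [m] exceeds a fixed multiple of [n]. *)

Definition scale_fun (R : realType) (s x : R) : R := s * x.

Lemma measurable_scale_fun (R : realType) (s : R) :
  measurable_fun setT (scale_fun s).
Proof. exact: measurable_funM. Qed.

Definition scale_mfun (R : realType) (s : R) :
    {mfun (measurableTypeR R) >-> R} :=
  HB.pack (scale_fun s)
    (@isMeasurableFun.Build _ _ (measurableTypeR R) R (scale_fun s)
      (measurable_scale_fun s)).

(* The law of [s * g] for [g ~ N(0, 1)]; unlike [normal_prob 0 s], it is the
   right one (a Dirac mass) for [s = 0]. *)
Definition gauss (R : realType) (s : R) : probability R R :=
  distribution (normal_prob 0 1) (scale_mfun s).

Arguments gauss : simpl never.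

Lemma measurable_preimage d1 d2 (T1 : measurableType d1) (T2 : measurableType d2)
  (f : T1 -> T2) (B : set T2) :
  measurable_fun setT f -> measurable B -> measurable (f @^-1` B).
Proof. by move=> mf mB; rewrite -[_ @^-1` _]setTI; exact: mf. Qed.

Section Gaussian.
Variable R : realType.
Local Notation mu := (@lebesgue_measure R).

(** [g] and the Radon-Nikodym derivative of [nu] have the same integral over every measurable set,
    hence agree almost everywhere, and the change of variables for that derivative passes to [g]. *)
Lemma integral_density (nu : {finite_measure set (measurableTypeR R) -> \bar R})
    (g : R -> R) (f : R -> \bar R) :
  measurable_fun setT g -> (forall x, 0 <= g x) ->
  (forall A, measurable A -> nu A = \int[mu]_(x in A) (g x)%:E)%E ->
  measurable_fun setT f -> (forall x, 0 <= f x)%E ->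
  (\int[nu]_x f x = \int[mu]_x (f x * (g x)%:E))%E.
Proof.
move=> mg g0 nuE mf f0.
have mgE : measurable_fun setT (fun x : measurableTypeR R => (g x)%:E).
  exact/measurable_EFinP.
have numu : nu `<< mu.
  apply/null_content_dominatesP => A mA muA0; rewrite nuE//.
  by apply: null_set_integral => //; exact: measurable_funTS.
rewrite -(Radon_Nikodym_SigmaFinite.change_of_variables numu)//.
have mrn := measurable_int _ (Radon_Nikodym_SigmaFinite.f_integrable numu).
apply: ae_eq_integral => //; [exact: emeasurable_funM|exact: emeasurable_funM|].
have : ae_eq mu setT (Radon_Nikodym_SigmaFinite.f nu mu)
    (fun x : R => (g x)%:E).
  apply: integral_ae_eq => //.
    exact: Radon_Nikodym_SigmaFinite.f_integrable.
  by move=> E _ mE; rewrite -Radon_Nikodym_SigmaFinite.f_integral// nuE.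
by apply: filterS => x /= + xT => ->.
Qed.

Lemma integral_normal_prob (m s : R) (f : R -> \bar R) :
  measurable_fun setT f -> (forall x, 0 <= f x)%E ->
  (\int[normal_prob m s]_x f x = \int[mu]_x (f x * (normal_pdf m s x)%:E))%E.
Proof.
apply: integral_density => //; first exact: measurable_normal_pdf.
by move=> x; exact: normal_pdf_ge0.
Qed.

Lemma normal_peakE (s : R) : 0 < s ->
  normal_peak s = (s * Num.sqrt (pi *+ 2))^-1.
Proof.
move=> s0; rewrite /normal_peak -mulrnAr sqrtrM ?sqr_ge0//.
by rewrite sqrtr_sqr gtr0_norm.
Qed.

Lemma normal_pdf_affine (m s x : R) : 0 < s ->
  normal_pdf 0 1 x = s * normal_pdf m s (m + s * x).
Proof.
move=> s0; rewrite !normal_pdfE ?gt_eqF// mulrA; congr (_ * _).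
  by rewrite !normal_peakE// mul1r invfM mulVKf// gt_eqF.
rewrite /normal_fun; congr expR; rewrite !mulr2n.
by field; rewrite -mulr2n mulrn_eq0/= sqrf_eq0 gt_eqF.
Qed.

(** The right-hand side is a measure in [A] that gives []a, b]] its length, and Lebesgue measure is
    the only one. *)
Lemma lebesgue_measure_affine (m s : R) (A : set R) : 0 < s -> measurable A ->
  mu A = (s%:E * mu ((fun x => (m + s * x)%R) @^-1` A))%E.
Proof.
move=> s0 mA.
pose aff : measurableTypeR R -> measurableTypeR R := fun x => m + s * x.
have mf : measurable_fun setT aff.
  by apply: measurable_funD => //; exact: measurable_funM.
pose nu : {measure set (measurableTypeR R) -> \bar R} :=
  mscale (NngNum (ltW s0)) (pushforward mu aff).
have -> : (s%:E * mu ((fun x => (m + s * x)%R) @^-1` A))%E = nu mf A by [].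
apply: lebesgue_measure_unique => // _ [[a b]] _ <-.
have affE : aff @^-1` [set` `]a, b]] = [set` `](a - m) / s, (b - m) / s]].
  apply/seteqP; split => x; rewrite /= !in_itv/= ltr_pdivrMr// ler_pdivlMr//;
  by rewrite (mulrC x) ltrBlDl lerBrDl.
have -> : nu mf [set` `]a, b]] = (s%:E * mu (aff @^-1` [set` `]a, b]]))%E by [].
rewrite affE.
rewrite !lebesgue_measure_itv/= !lte_fin ltr_pM2r ?invr_gt0// ltrD2r.
case: ifPn => _; rewrite ?mule0//.
rewrite -!EFinD -EFinM; congr EFin; field.
by rewrite gt_eqF.
Qed.

Lemma normal_prob_affine (m s : R) (B : set R) : 0 < s -> measurable B ->
  normal_prob 0 1 ((fun x => m + s * x) @^-1` B) = normal_prob m s B.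
Proof.
move=> s0 mB.
pose aff : measurableTypeR R -> measurableTypeR R := fun x => m + s * x.
have mf : measurable_fun setT aff.
  by apply: measurable_funD => //; exact: measurable_funM.
have mpdf : measurable_fun setT (fun x : R => (normal_pdf m s x)%:E).
  by apply/measurable_EFinP; exact: measurable_normal_pdf.
pose nu : {measure set (measurableTypeR R) -> \bar R} :=
  mscale (NngNum (ltW s0)) (pushforward mu aff).
rewrite {2}/normal_prob.
transitivity (\int[nu mf]_(x in B) (normal_pdf m s x)%:E)%E; last first.
  apply: eq_measure_integral => A mA _.
  by rewrite /nu /= /mscale /pushforward/= -lebesgue_measure_affine.
rewrite ge0_integral_mscale//; last 2 first.
- exact: measurable_funTS.
- by move=> x _; rewrite lee_fin normal_pdf_ge0.
rewrite ge0_integral_pushforward//; last 2 first.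
- exact: measurable_funTS.
- by move=> x _; rewrite lee_fin normal_pdf_ge0.
rewrite -ge0_integralZl//=; last 4 first.
- exact: (measurable_preimage mf mB).
- by apply: measurable_funTS; exact: (measurableT_comp mpdf mf).
- by move=> x _; rewrite lee_fin normal_pdf_ge0.
- by rewrite lee_fin ltW.
apply: eq_integral => x _; rewrite /= -EFinM; congr EFin.
exact: normal_pdf_affine.
Qed.

Lemma normal_prob_sym (B : set R) : measurable B ->
  normal_prob 0 1 (-%R @^-1` B) = normal_prob 0 1 B.
Proof.
move=> mB; have mpdf : measurable_fun setT (fun x : R => (normal_pdf 0 1 x)%:E).
  by apply/measurable_EFinP; exact: measurable_normal_pdf.
pose opp : measurableTypeR R -> measurableTypeR R := -%R.
have mopp : measurable_fun setT opp by exact: oppr_measurable.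
rewrite {2}/normal_prob.
pose nu : {measure set (measurableTypeR R) -> \bar R} := pushforward mu opp.
transitivity (\int[nu mopp]_(x in B) (normal_pdf 0 1 x)%:E)%E; last first.
  by apply: eq_measure_integral => A mA _; exact: lebesgue_measureN.
have -> : (\int[nu mopp]_(x in B) (normal_pdf 0 1 x)%:E =
    \int[mu]_(x in opp @^-1` B) (normal_pdf 0 1 (opp x))%:E)%E.
  apply: ge0_integral_pushforward => //; first exact: measurable_funTS.
  by move=> x _; rewrite lee_fin normal_pdf_ge0.
apply: eq_integral => x _; rewrite /=; congr EFin.
rewrite !normal_pdfE ?oner_neq0//; congr (_ * expR _).
by rewrite !subr0 sqrrN.
Qed.

(** The two factorizations of the joint density of [x] and [u = a x + b y]: on the left, [x] and
    then [u] given [x]; on the right, the marginal of [u] and then [x] given [u], found by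
    completing the square. *)
Lemma normal_pdf_conv (a b c x u : R) : 0 < b -> 0 < c ->
  c ^+ 2 = a ^+ 2 + b ^+ 2 ->
  normal_pdf 0 1 x * normal_pdf (a * x) b u =
  normal_pdf 0 c u * normal_pdf (a * u / c ^+ 2) (b / c) x.
Proof.
move=> b0 c0 c2; rewrite !normal_pdfE ?gt_eqF ?divr_gt0//.
rewrite [LHS]mulrACA [RHS]mulrACA !normal_peakE ?divr_gt0//; congr (_ * _).
  have p0 : Num.sqrt (pi *+ 2) != 0 :> R.
    by rewrite gt_eqF// sqrtr_gt0 pmulrn_rgt0// pi_gt0.
  by field; rewrite p0 !gt_eqF.
rewrite /normal_fun -!expRD; congr expR; rewrite !mulr2n exprMn exprVn c2.
have D0 : a ^+ 2 + b ^+ 2 != 0 by rewrite -c2 gt_eqF// exprn_gt0.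
by field; rewrite D0 -!mulr2n !mulrn_eq0/= D0 sqrf_eq0 gt_eqF.
Qed.

Lemma gaussE (s : R) (B : set R) :
  gauss s B = normal_prob 0 1 ((fun x => s * x) @^-1` B).
Proof. by []. Qed.

Lemma normal_prob_affine_norm (m s : R) (B : set R) : measurable B ->
  normal_prob 0 1 ((fun x => m + `|s| * x) @^-1` B) =
  normal_prob 0 1 ((fun x => m + s * x) @^-1` B).
Proof.
move=> mB; have [s0|s0] := ger0P s => //.
rewrite -[RHS]normal_prob_sym; last first.
  apply: measurable_preimage => //.
  by apply: measurable_funD => //; exact: measurable_funM.
congr (normal_prob 0 1 _); apply/funext => x.
by rewrite /preimage/= mulrN mulNr.
Qed.

Lemma gauss_norm (s : R) (B : set R) : measurable B ->
  gauss `|s| B = gauss s B.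
Proof.
move=> mB; rewrite !gaussE.
have := normal_prob_affine_norm 0 s mB.
by under eq_fun do rewrite add0r; under [in RHS]eq_fun do rewrite add0r.
Qed.

Lemma gauss_normal_prob (s : R) (B : set R) : 0 < s -> measurable B ->
  gauss s B = normal_prob 0 s B.
Proof.
move=> s0 mB; rewrite -(normal_prob_affine 0 s0 mB) gaussE.
by congr (normal_prob 0 1 _); apply/funext => x; rewrite /preimage/= add0r.
Qed.

(** After exchanging the integrals, [normal_pdf_conv] leaves a density in [x] of total mass 1 next
    to the density of [u]. *)
Lemma normal_prob_conv (a b c : R) (B : set R) : 0 < b -> 0 < c ->
  c ^+ 2 = a ^+ 2 + b ^+ 2 -> measurable B ->
  (\int[mu]_x (normal_prob (a * x)%R b B * (normal_pdf 0 1 x)%:E) =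
   normal_prob 0 c B)%E.
Proof.
move=> b0 c0 cE mB.
pose f (xu : R * R) : \bar R :=
  (\1_B xu.2 * (normal_pdf 0 1 xu.1 * normal_pdf (a * xu.1) b xu.2))%:E.
have f0 xu : (0 <= f xu)%E by rewrite lee_fin !mulr_ge0 ?normal_pdf_ge0.
have mf : measurable_fun setT f.
  apply/measurable_EFinP; apply: measurable_funM.
    exact: (measurableT_comp (measurable_indic mB)).
  apply: measurable_funM.
    exact: (measurableT_comp (measurable_normal_pdf 0 1)).
  rewrite (_ : (fun _ => _) = fun xu : R * R => normal_peak b *
      expR (- (xu.2 - a * xu.1) ^+ 2 / (b ^+ 2 *+ 2))); last first.
    by apply/funext => xu; rewrite normal_pdfE ?gt_eqF.
  apply: measurable_funM => //; apply: measurableT_comp => //.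
  apply: measurable_funM => //; apply: measurableT_comp => //.
  apply: measurable_funX; apply: measurable_funB => //.
  exact: measurable_funM.
have mpdf m s : measurable_fun setT (fun x : R => (normal_pdf m s x)%:E).
  by apply/measurable_EFinP; exact: measurable_normal_pdf.
transitivity (\int[mu]_x \int[mu]_u f (x, u))%E.
  apply: eq_integral => x _.
  rewrite /normal_prob integral_mkcond muleC -ge0_integralZl//; last 3 first.
  - by apply/(measurable_restrictT _ mB); apply: measurable_funTS; exact: mpdf.
  - move=> u _; rewrite patchE; case: ifP => // _.
    by rewrite lee_fin normal_pdf_ge0.
  - by rewrite lee_fin normal_pdf_ge0.
  apply: eq_integral => u _; rewrite /f/= patchE indicE.
  by case: ifPn => _; rewrite ?mule0 ?mul0r// mul1r EFinM.
rewrite fubini_tonelli//.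
rewrite /normal_prob [RHS]integral_mkcond; apply: eq_integral => u _.
rewrite patchE /f/=.
under eq_integral do rewrite (normal_pdf_conv _ _ b0 c0 cE).
rewrite indicE; case: ifPn => uB; last first.
  by apply: integral0_eq => x _; rewrite mul0r.
under eq_integral do rewrite mul1r EFinM.
rewrite ge0_integralZl//; last 3 first.
- exact: mpdf.
- by move=> x _; rewrite lee_fin normal_pdf_ge0.
- by rewrite lee_fin normal_pdf_ge0.
by rewrite integral_normal_pdf mule1.
Qed.

(** Given the first coordinate [x], the sum is normal with mean [x] and deviation [|b|], so
    [normal_prob_conv] applies; [b = 0] has no density and is treated apart. The coefficient [a] is
    arbitrary, so that sums can be built up from the constant 0. *)
Lemma gauss_convolution (a b : R) (B : set R) : measurable B ->
  product_measure1 (gauss a) (gauss 1) ((fun xy => xy.1 + b * xy.2) @^-1` B) =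
  gauss (Num.sqrt (a ^+ 2 + b ^+ 2)) B.
Proof.
move=> mB; have [->|b0] := eqVneq b 0.
  rewrite expr0n addr0 sqrtr_sqr gauss_norm//.
  rewrite (_ : _ @^-1` B = B `*` setT); last first.
    by apply/seteqP; split => -[x y]; rewrite /= mul0r addr0 => // -[].
  rewrite product_measure1E//.
  rewrite -[RHS]mule1; congr (_ * _)%E.
  exact: (@probability_setT _ _ _ (gauss (1 : R))).
set c := Num.sqrt _.
have c2 : c ^+ 2 = a ^+ 2 + `|b| ^+ 2.
  by rewrite real_normK ?num_real// sqr_sqrtr// addr_ge0// sqr_ge0.
have c0 : 0 < c.
  by rewrite sqrtr_gt0 ltr_wpDl ?sqr_ge0// exprn_even_gt0.
have nb0 : 0 < `|b| by rewrite normr_gt0.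
rewrite gauss_normal_prob// -(normal_prob_conv nb0 c0 c2 mB).
set S := _ @^-1` B.
have mS : measurable S.
  apply: measurable_preimage => //.
  by apply: measurable_funD => //; exact: measurable_funM.
pose F x := gauss 1 (xsection S (a * x)).
have FE x : F x = normal_prob (a * x) `|b| B.
  rewrite -normal_prob_affine// normal_prob_affine_norm// /F gaussE.
  congr (normal_prob 0 1 _); apply/seteqP; split => y;
    by rewrite /S xsectionE /preimage/= mul1r.
have mxS : measurable_fun setT (gauss 1 \o xsection S).
  exact: measurable_fun_xsection.
have mF : measurable_fun setT F.
  by apply: (measurableT_comp mxS); exact: measurable_funM.
transitivity (\int[normal_prob 0 1]_x F x)%E.
  exact: (ge0_integral_distribution (scale_mfun a) mxS).
have F0 x : (0 <= F x)%E by exact: measure_ge0.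
have := @integral_normal_prob 0 1 F mF F0.
move=> IF.
transitivity (\int[mu]_x (F x * (normal_pdf 0 1 x)%:E))%E.
  exact: IF.
by apply: eq_integral => x _; rewrite FE.
Qed.
End Gaussian.

(** * Integrals against the standard Gaussian law *)

Section GaussianIntegrals.
Variable R : realType.
Local Notation mu := (@lebesgue_measure R).

Lemma integral_gauss1 (f : R -> \bar R) :
  measurable_fun setT f -> (forall x, 0 <= f x)%E ->
  (\int[gauss 1]_x f x = \int[normal_prob 0 1]_x f x)%E.
Proof.
move=> mf f0; transitivity (\int[normal_prob 0 1]_x (f \o scale_mfun 1) x)%E.
  exact: (ge0_integral_distribution (scale_mfun 1) mf).
by apply: eq_integral => x _; rewrite /= /scale_fun mul1r.
Qed.

Lemma gauss1_exp_abs (c : R) :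
  (\int[gauss 1]_x (expR (c * `|x|))%:E < +oo)%E.
Proof.
have mexp : measurable_fun setT (fun x : R => (expR (c * `|x|))%:E).
  apply/measurable_EFinP; apply: measurableT_comp => //.
  by apply: measurable_funM => //; exact: normr_measurable.
have exp0 (x : R) : (0 <= (expR (c * `|x|))%:E)%E by rewrite lee_fin expR_ge0.
rewrite integral_gauss1//.
have := @integral_normal_prob R 0 1 _ mexp exp0 => ->.
(* Comparison with the normal density of variance 2: [c |x| - x ^ 2 / 2 <= c ^ 2 - x ^ 2 / 4]
   amounts to [0 <= (|x| / 2 - c) ^ 2]. The constant [K] also corrects the ratio of the peaks. *)
pose s : R := Num.sqrt 2.
have s0 : 0 < s by rewrite sqrtr_gt0.
have s2 : s ^+ 2 = 2 by rewrite sqr_sqrtr.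
pose K := expR (c ^+ 2) * (normal_peak 1 / normal_peak s).
have K0 : 0 <= K.
  by rewrite mulr_ge0 ?expR_ge0// divr_ge0// normal_peak_ge0.
have mpdf (m t : R) : measurable_fun setT (fun x : R => (normal_pdf m t x)%:E).
  by apply/measurable_EFinP; exact: measurable_normal_pdf.
apply: (@le_lt_trans _ _ (\int[mu]_x (K%:E * (normal_pdf 0 s x)%:E))%E).
  apply: ge0_le_integral => //.
  - by move=> x _; rewrite mule_ge0// lee_fin normal_pdf_ge0.
  - by apply: emeasurable_funM => //; exact: mpdf.
  - by apply: emeasurable_funM => //; exact: mpdf.
  move=> x _; rewrite -!EFinM lee_fin /K !normal_pdfE ?gt_eqF//.
  rewrite -mulrA (mulrA _ (normal_peak s)) divfK ?gt_eqF ?normal_peak_gt0 ?gt_eqF//.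
  rewrite mulrCA [leRHS]mulrCA ler_pM2l ?normal_peak_gt0 ?oner_neq0//.
  rewrite /normal_fun -!expRD ler_expR !subr0 s2 expr1n.
  rewrite -[x ^+ 2]real_normK ?num_real//.
  have : 0 <= (`|x| / 2 - c) ^+ 2 by exact: sqr_ge0.
  have -> : (2 : R) *+ 2 = 4 by rewrite -mulrnA.
  by nra.
rewrite ge0_integralZl//; last 2 first.
- exact: mpdf.
- by move=> x _; rewrite lee_fin normal_pdf_ge0.
by rewrite integral_normal_pdf mule1 ltry.
Qed.

Lemma abs_normal_pdf_ge0 (x : R) : 0 <= abs_normal_pdf x.
Proof.
by rewrite /abs_normal_pdf; case: ifP => // _; rewrite addr_ge0 ?normal_pdf_ge0.
Qed.

Lemma measurable_abs_normal_pdf : measurable_fun setT (@abs_normal_pdf R).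
Proof.
apply: measurable_fun_ifT => //; first exact: measurable_fun_ler.
apply: measurable_funD; first exact: measurable_normal_pdf.
by apply: measurableT_comp; [exact: measurable_normal_pdf|exact: oppr_measurable].
Qed.

(** Connects the integrals over a half-line that define [zstar] with expectations of functions of a
    Gaussian entry. *)
Lemma integral_gauss1_abs (f : R -> \bar R) :
  measurable_fun setT f -> (forall x, 0 <= f x)%E ->
  (\int[gauss 1]_x f `|x|%R =
   \int[mu]_(x in `[0%R, +oo[) (f x * (abs_normal_pdf x)%:E))%E.
Proof.
move=> mf f0.
pose absf : measurableTypeR R -> measurableTypeR R := fun x => `|x|.
have mabs : measurable_fun setT absf by exact: normr_measurable.
pose absm : {mfun (measurableTypeR R) >-> (measurableTypeR R)} :=
  HB.pack absf (@isMeasurableFun.Build _ _ (measurableTypeR R)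
    (measurableTypeR R) absf mabs).
pose nu := distribution (normal_prob 0 1) absm.
have mfa : measurable_fun setT (fun x : R => f `|x|).
  by apply: (measurableT_comp mf); exact: normr_measurable.
rewrite integral_gauss1//.
transitivity (\int[nu]_x f x)%E.
  by rewrite (ge0_integral_distribution absm mf).
have := @integral_density R nu (@abs_normal_pdf R) f measurable_abs_normal_pdf
  abs_normal_pdf_ge0.
move=> ->//; last by move=> A mA; rewrite -abs_normal_pdfP.
rewrite [RHS]integral_mkcond; apply: eq_integral => x _; rewrite patchE.
case: ifPn => // /negP; rewrite inE/= in_itv/= andbT => /negP x0.
by rewrite /abs_normal_pdf (negbTE x0) mule0.
Qed.

End GaussianIntegrals.

(** * Independence *)

Section Independence.
Context d (T : measurableType d) (R : realType) (P : probability T R).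

(** Under [P] restricted to [C] and divided by [P C], the law of [(U, V)] agrees with the product
    measure on rectangles, which determine it. If [C] is null, both sides vanish. *)
Lemma joint_law d1 d2 (T1 : measurableType d1) (T2 : measurableType d2)
    (U : T -> T1) (V : T -> T2) (mU : measurable_fun setT U)
    (mV : measurable_fun setT V) (mu : probability T1 R) (nu : probability T2 R)
    (C : set T) (mC : measurable C) :
  (forall A B, measurable A -> measurable B ->
     P (U @^-1` A `&` V @^-1` B `&` C) = (mu A * nu B * P C)%E) ->
  forall S, measurable S ->
    P ((fun w => (U w, V w)) @^-1` S `&` C) = (product_measure1 mu nu S * P C)%E.
Proof.
move=> UV S mS.
have mUV : measurable_fun setT (fun w => (U w, V w)).
  exact: measurable_fun_pair.
have PCfin : P C \is a fin_num by exact: fin_num_measure.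
have := @measure_ge0 _ _ _ P C; rewrite le_eqVlt => /orP[/eqP PC0|PC0].
  rewrite -PC0 mule0; apply/eqP; rewrite eq_le measure_ge0 andbT.
  rewrite PC0 le_measure ?inE//; apply: measurableI => //.
  exact: measurable_preimage.
have c0 : 0 < fine (P C) by rewrite fine_gt0// PC0 ltey_eq PCfin.
have ic0 : 0 <= (fine (P C))^-1 by rewrite invr_ge0 ltW.
pose k := NngNum ic0.
pose m' : {measure set (T1 * T2) -> \bar R} :=
  mscale k (pushforward (mrestr P mC) (fun w => (U w, V w))).
have -> : product_measure1 mu nu S = m' mUV S.
  apply: product_measure_unique mS => A B mA mB.
  have -> : m' mUV (A `*` B) =
    ((fine (P C))^-1%:E * P (U @^-1` A `&` V @^-1` B `&` C))%E by [].
  rewrite UV// muleC -{1}(fineK PCfin) -muleA -EFinM divff ?mule1// gt_eqF//.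
have -> : m' mUV S =
  ((fine (P C))^-1%:E * P ((fun w => (U w, V w)) @^-1` S `&` C))%E by [].
rewrite muleAC -[in X in _ = (X * _)%E](fineK PCfin) -EFinM mulVf ?mul1e//.
by rewrite gt_eqF.
Qed.

(* [C] collects the events about the variables that are not merged yet. *)
Lemma indep_merge d1 d2 d3 (T1 : measurableType d1) (T2 : measurableType d2)
    (T3 : measurableType d3) (U : T -> T1) (V : T -> T2)
    (h : T1 * T2 -> T3) (mU : measurable_fun setT U)
    (mV : measurable_fun setT V) (mh : measurable_fun setT h)
    (mu : probability T1 R) (nu : probability T2 R) (C : set T)
    (mC : measurable C) :
  (forall A B, measurable A -> measurable B ->
     P (U @^-1` A `&` V @^-1` B `&` C) = (mu A * nu B * P C)%E) ->
  forall D, measurable D ->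
    P ((fun w => h (U w, V w)) @^-1` D `&` C) =
    (product_measure1 mu nu (h @^-1` D) * P C)%E.
Proof.
move=> UV D mD.
by rewrite -(joint_law mU mV mC UV)//; exact: measurable_preimage.
Qed.

Lemma measurable_big_preimage (J : Type) (s : seq J) d' (T' : measurableType d')
  (X : J -> T -> T') (B : J -> set T') :
  (forall j, measurable_fun setT (X j)) -> (forall j, measurable (B j)) ->
  measurable (\big[setI/setT]_(j <- s) (X j @^-1` B j)).
Proof.
move=> mX mB; elim/big_ind: _ => //; first exact: measurableI.
by move=> j _; exact: measurable_preimage.
Qed.

(** Induction on [s], for all [a] and [Y] at once: each step absorbs the term [z j * X j] into [Y],
    and [gauss_convolution] updates the deviation from [a] to the square root of [a ^ 2 + z j ^ 2].
    The hypothesis carries the events of all variables still to be absorbed. *)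
Lemma lincomb_law (J : eqType) (X : J -> T -> R) (z : J -> R) (s : seq J)
    (a : R) (Y : T -> R) (C : set T) :
  uniq s -> (forall j, measurable_fun setT (X j)) -> measurable_fun setT Y ->
  measurable C ->
  (forall B (BX : J -> set R), measurable B -> (forall j, measurable (BX j)) ->
     P (Y @^-1` B `&` (\big[setI/setT]_(j <- s) (X j @^-1` BX j) `&` C)) =
     (gauss a B * ((\prod_(j <- s) gauss 1 (BX j)) * P C))%E) ->
  forall B, measurable B ->
    P ((fun w => Y w + \sum_(j <- s) z j * X j w) @^-1` B `&` C) =
    (gauss (Num.sqrt (a ^+ 2 + \sum_(j <- s) z j ^+ 2)) B * P C)%E.
Proof.
move=> + mX + mC.
elim: s a Y => [a Y _ mY YC B mB|j s IH a Y /= /andP[js us] mY YC B mB].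
  have := YC B (fun=> setT) mB (fun=> measurableT).
  rewrite !big_nil setTI mul1e addr0 sqrtr_sqr => YC'.
  transitivity (gauss a B * P C)%E; last by congr (_ * _)%E; rewrite -gauss_norm.
  rewrite -YC'; congr (P (_ `&` C)).
  by apply/funext => w; rewrite /preimage/= big_nil addr0.
rewrite big_cons addrA.
rewrite (_ : (fun w => Y w + _) =
    (fun w => Y w + z j * X j w + \sum_(i <- s) z i * X i w)); last first.
  by apply/funext => w; rewrite big_cons addrA.
have := IH (Num.sqrt (a ^+ 2 + z j ^+ 2)) (fun w => Y w + z j * X j w) us.
rewrite sqr_sqrtr ?addr_ge0 ?sqr_ge0//; apply => //.
  by apply: measurable_funD => //; exact: measurable_funM.
move=> {mB}D BX mD mBX.
set E := \big[setI/setT]_(i <- s) _.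
pose q := (\prod_(i <- s) gauss 1 (BX i))%E.
have YXC A B' : measurable A -> measurable B' ->
    P (Y @^-1` A `&` X j @^-1` B' `&` (E `&` C)) =
    (gauss a A * gauss 1 B' * (q * P C))%E.
  move=> mA mB'.
  (* Since [j] is not in [s], the family [BX] can be changed at [j] without affecting the events
     indexed by [s]. *)
  have Ej : \big[setI/setT]_(i <- s) (X i @^-1` (if i == j then B' else BX i)) = E.
    by apply: eq_big_seq => i si; case: ifPn => // /eqP ij; rewrite -ij si in js.
  have qj : (\prod_(i <- s) gauss 1 (if i == j then B' else BX i))%E = q.
    by apply: eq_big_seq => i si; case: ifPn => // /eqP ij; rewrite -ij si in js.
  have := YC A (fun i => if i == j then B' else BX i) mA.
  rewrite !big_cons eqxx Ej qj -!setIA.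
  by move=> ->; [rewrite -!muleA|move=> i; case: ifP].
have mE : measurable (E `&` C).
  by apply: measurableI => //; exact: measurable_big_preimage.
have PEC : P (E `&` C) = (q * P C)%E.
  have := YXC setT setT measurableT measurableT.
  by rewrite !preimage_setT !setTI !probability_setT !mul1e.
rewrite -/q -PEC -(gauss_convolution _ _ mD).
have mh : measurable_fun setT (fun xy : R * R => xy.1 + z j * xy.2).
  by apply: measurable_funD => //; exact: measurable_funM.
apply: (indep_merge mY (mX j) mh mE) => // A B' mA mB'.
by rewrite YXC// PEC.
Qed.

Lemma indep_integralM (U : {mfun T >-> R}) (Y : T -> R)
    (mY : measurable_fun setT Y) (nu : probability R R) (G : R -> R) :
  measurable_fun setT G -> (forall x, 0 <= G x) -> (forall w, 0 <= U w) ->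
  (forall A B, measurable A -> measurable B ->
     P (U @^-1` A `&` Y @^-1` B) = (P (U @^-1` A) * nu B)%E) ->
  (\int[P]_w (U w * G (Y w))%:E =
   (\int[P]_w (U w)%:E) * \int[nu]_y (G y)%:E)%E.
Proof.
move=> mG G0 U0 UY.
(* The absolute value makes [h] nonnegative on the whole plane, as Tonelli requires; it changes
   nothing on the range of [U]. *)
pose h (xy : R * R) : \bar R := (`|xy.1| * G xy.2)%:E.
have mh : measurable_fun setT h.
  apply/measurable_EFinP; apply: measurable_funM.
    exact: measurableT_comp.
  exact: (measurableT_comp mG).
have h0 xy : (0 <= h xy)%E by rewrite lee_fin mulr_ge0.
have EG0 y : [set: R] y -> (0 <= (G y)%:E)%E by rewrite lee_fin.
have mUY : measurable_fun setT (fun w => (U w, Y w)).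
  exact: measurable_fun_pair.
transitivity (\int[P]_w (h \o (fun w => (U w, Y w))) w)%E.
  by apply: eq_integral => w _; rewrite /h /= ger0_norm.
rewrite -(@ge0_integral_pushforward _ _ _ _ _ _ mUY P setT h)//.
transitivity (\int[product_measure1 (distribution P U) nu]_xy h xy)%E.
  apply: eq_measure_integral => S mS _.
  have : P ((fun w => (U w, Y w)) @^-1` S `&` setT) =
      (product_measure1 (distribution P U) nu S * P setT)%E.
    apply: (joint_law _ mY measurableT) => // A B mA mB.
    by rewrite setIT UY// probability_setT mule1.
  by rewrite setIT probability_setT mule1.
rewrite fubini_tonelli1//.
transitivity (\int[distribution P U]_x (`|x|%:E * \int[nu]_y (G y)%:E))%E.
  apply: eq_integral => x _; rewrite /fubini_F /h /=.
  under eq_integral do rewrite EFinM.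
  by rewrite ge0_integralZl//; exact/measurable_EFinP.
have mabs : measurable_fun setT (fun x : R => `|x|%:E).
  by apply/measurable_EFinP; exact: normr_measurable.
rewrite ge0_integralZr//; last exact: integral_ge0.
congr (_ * _)%E.
rewrite ge0_integral_distribution//.
by apply: eq_integral => w _; rewrite /= ger0_norm.
Qed.

(** Induction on the rows: [U] accumulates the factors of the rows already treated, and the work
    lies in showing that [U * G (Y)] is again independent of the rows that remain. The sum [Y] of a
    row is standard normal because [z] is a unit vector. *)
Lemma integral_prod_rows (I J : eqType) (X : I -> J -> {mfun T >-> R})
    (z : J -> R) (r : seq I) (s : seq J) (G : R -> R) (U : {mfun T >-> R}) :
  uniq r -> uniq s -> \sum_(j <- s) z j ^+ 2 = 1 ->
  measurable_fun setT G -> (forall x, 0 <= G x) -> (forall w, 0 <= U w) ->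
  (forall (A : set R) (BX : I -> J -> set R), measurable A ->
     (forall i j, measurable (BX i j)) ->
     P (U @^-1` A `&` \big[setI/setT]_(i <- r) \big[setI/setT]_(j <- s)
          (X i j @^-1` BX i j)) =
     (P (U @^-1` A) *
      \prod_(i <- r) \prod_(j <- s) gauss 1 (BX i j))%E) ->
  (\int[P]_w (U w * \prod_(i <- r) G (\sum_(j <- s) z j * X i j w))%:E =
   (\int[P]_w (U w)%:E) * \prod_(i <- r) \int[gauss 1]_y (G y)%:E)%E.
Proof.
move=> + us z1 mG G0.
elim: r U => [U _ U0 _|i r IH U /= /andP[ir ur] U0 UX].
  rewrite big_nil mule1; apply: eq_integral => w _.
  by rewrite big_nil mulr1.
pose Y w := \sum_(j <- s) z j * X i j w.
have mY : measurable_fun setT Y.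
  by apply: measurable_sum => j; exact: measurable_funM.
pose E (BX : I -> J -> set R) :=
  \big[setI/setT]_(k <- r) \big[setI/setT]_(j <- s) (X k j @^-1` BX k j).
have mE BX : (forall i j, measurable (BX i j)) -> measurable (E BX).
  move=> mBX; apply: bigsetI_measurable => k _.
  exact: measurable_big_preimage.
pose q (BX : I -> J -> set R) :=
  (\prod_(k <- r) \prod_(j <- s) gauss 1 (BX k j))%E.
have UYE A B BX : measurable A -> measurable B ->
    (forall k j, measurable (BX k j)) ->
    P (U @^-1` A `&` Y @^-1` B `&` E BX) =
    (P (U @^-1` A) * gauss 1 B * q BX)%E.
  move=> mA mB mBX.
  have PXC BX0 : (forall j, measurable (BX0 j)) ->
      P (\big[setI/setT]_(j <- s) (X i j @^-1` BX0 j) `&` (U @^-1` A `&` E BX)) =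
      (\prod_(j <- s) gauss 1 (BX0 j) * (P (U @^-1` A) * q BX))%E.
    move=> mBX0; pose BX' k := if k == i then BX0 else BX k.
    have mBX' k j : measurable (BX' k j) by rewrite /BX'; case: ifP.
    have EE : E BX' = E BX.
      apply: eq_big_seq => k kr; rewrite /BX'; case: ifPn => // /eqP ki.
      by rewrite -ki kr in ir.
    have qq : q BX' = q BX.
      apply: eq_big_seq => k kr; rewrite /BX'; case: ifPn => // /eqP ki.
      by rewrite -ki kr in ir.
    have := UX A BX' mA mBX'.
    rewrite !big_cons -/(E BX') -/(q BX') EE qq /BX' eqxx => UXA.
    by rewrite setICA UXA muleCA.
  have PC : P (U @^-1` A `&` E BX) = (P (U @^-1` A) * q BX)%E.
    have := PXC (fun=> setT) (fun=> measurableT).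
    rewrite big1_seq; last by move=> j _; rewrite preimage_setT.
    rewrite big1_seq; last by move=> j _; rewrite probability_setT.
    by rewrite setTI mul1e.
  have mC : measurable (U @^-1` A `&` E BX).
    by apply: measurableI; [exact: measurable_preimage|exact: mE].
  rewrite (setIC (U @^-1` A)) -setIA muleAC.
  rewrite -PC muleC.
  (* The summation starts from the constant 0, whose law [gauss 0] is the Dirac mass at 0; its
     events are therefore full or empty, according to whether they contain 0. *)
  have := @lincomb_law J (X i) z s 0 (cst 0) (U @^-1` A `&` E BX) us _ _ mC.
  have -> : (0 : R) ^+ 2 + \sum_(j <- s) z j ^+ 2 = 1.
    by rewrite z1 expr0n add0r.
  rewrite sqrtr1 => L.
  rewrite -L//; last first.
    move=> B0 BX0 mB0 mBX0; rewrite preimage_cst PC; case: ifPn => [B00|B00].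
      rewrite setTI PXC//; have -> : gauss 0 B0 = 1%E.
        rewrite -(@probability_setT _ _ _ (normal_prob (0 : R) 1)).
        congr (normal_prob 0 1 _); apply/seteqP; split => // x _.
        by rewrite /preimage /= /scale_fun mul0r; exact/set_mem.
      by rewrite mul1e.
    rewrite set0I measure0; have -> : gauss 0 B0 = 0%E.
      rewrite -(@measure0 _ _ _ (normal_prob (0 : R) 1)).
      congr (normal_prob 0 1 _); apply/seteqP; split => // x.
      by rewrite /preimage /= /scale_fun mul0r => /mem_set; rewrite (negbTE B00).
    by rewrite mul0e.
  congr (P (_ `&` _)); apply/funext => w.
  by rewrite /preimage/= add0r.
pose U'f w := U w * G (Y w).
have mU' : measurable_fun setT U'f.
  by apply: measurable_funM => //; exact: (measurableT_comp mG).
pose U' : {mfun T >-> R} := HB.pack U'f (@isMeasurableFun.Build _ _ T R U'f mU').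
have UY A B : measurable A -> measurable B ->
    P (U @^-1` A `&` Y @^-1` B) = (P (U @^-1` A) * gauss 1 B)%E.
  move=> mA mB; have := UYE A B (fun _ _ => setT) mA mB (fun _ _ => measurableT).
  rewrite /E /q big1_seq; last first.
    by move=> k _; rewrite big1_seq// => j _; rewrite preimage_setT.
  rewrite big1_seq; last first.
    by move=> k _; rewrite big1_seq// => j _; rewrite probability_setT.
  by rewrite setIT mule1.
under eq_integral do rewrite big_cons mulrA.
rewrite big_cons muleA -(indep_integralM mY)//.
rewrite -(IH U')//=; first by move=> w; rewrite mulr_ge0.
move=> A BX mA mBX.
pose h (uy : R * R) : R := uy.1 * G uy.2.
have mh : measurable_fun setT h.
  by apply: measurable_funM => //; exact: (measurableT_comp mG).
(* With [C = setT] this gives the law of [U']; with [C = E BX], its independence of the remaining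
   rows. *)
have UYC C : measurable C ->
    (forall A0 B0, measurable A0 -> measurable B0 ->
     P (U @^-1` A0 `&` Y @^-1` B0 `&` C) = (P (U @^-1` A0) * gauss 1 B0 * P C)%E) ->
    P (U'f @^-1` A `&` C) =
    (product_measure1 (distribution P U) (gauss 1) (h @^-1` A) * P C)%E.
  by move=> mC UYC; exact: (@indep_merge _ _ _ R R R U Y h (measurable_funPT U) mY mh
    (distribution P U) (gauss 1) C mC UYC A mA).
have PE : P (E BX) = q BX.
  have := UYE setT setT BX measurableT measurableT mBX.
  by rewrite !preimage_setT !setTI !probability_setT !mul1e.
have PU' : P (U'f @^-1` A) =
    product_measure1 (distribution P U) (gauss 1) (h @^-1` A).
  have := UYC setT measurableT; rewrite setIT probability_setT mule1; apply.
  by move=> A0 B0 mA0 mB0; rewrite setIT UY// mule1.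
have -> : (P (U'f @^-1` A) * (\prod_(k <- r) \prod_(j <- s) gauss 1 (BX k j)))%E =
    (product_measure1 (distribution P U) (gauss 1) (h @^-1` A) * P (E BX))%E.
  by rewrite PU' PE.
apply: UYC; first exact: mE.
by move=> A0 B0 mA0 mB0; rewrite PE; exact: UYE.
Qed.
End Independence.

(** * The threshold *)

Section ZStar.
Variables (R : realType) (p : R).
Hypotheses (hp0 : 0 < p) (hp1 : p <= 1).
Local Notation mu := (@lebesgue_measure R).

Lemma onepowR (r : R) : 1 `^ r = 1.
Proof. by rewrite powR1. Qed.

Lemma powR_le1D (x : R) : 0 <= x -> x `^ p <= 1 + x.
Proof.
move=> x0; have [x1|x1] := leP 1 x.
  by rewrite (le_trans (ler1_powR x1 hp1))// lerDr.
rewrite -[leLHS]addr0; apply: lerD => //; rewrite -(onepowR p).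
by apply: ge0_ler_powR; rewrite ?nnegrE ?ler01// ltW.
Qed.

Let h (x : R) : R := x `^ p * abs_normal_pdf x.

Let h0 x : 0 <= h x.
Proof. by rewrite mulr_ge0 ?powR_ge0// abs_normal_pdf_ge0. Qed.

Let mh : measurable_fun setT (fun x : measurableTypeR R => (h x)%:E).
Proof.
apply/measurable_EFinP; apply: measurable_funM.
  exact: measurable_powR.
exact: measurable_abs_normal_pdf.
Qed.

Lemma measurable_abs_powR : measurable_fun setT (fun x : R => `|x| `^ p).
Proof.
by apply: (measurableT_comp (measurable_powR p)); exact: normr_measurable.
Qed.

Lemma gauss1_abs_powR :
  (\int[gauss 1]_x (`|x| `^ p)%:E = \int[mu]_(x in `[0%R, +oo[) (h x)%:E)%E.
Proof.
have mf : measurable_fun setT (fun x : R => (x `^ p)%:E).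
  by apply/measurable_EFinP; exact: measurable_powR.
rewrite (integral_gauss1_abs mf); last by move=> x; rewrite lee_fin powR_ge0.
by apply: eq_integral => x _; rewrite EFinM.
Qed.

Lemma gauss1_abs_powR_lty : (\int[gauss 1]_x (`|x| `^ p)%:E < +oo)%E.
Proof.
apply: le_lt_trans (gauss1_exp_abs 1); apply: ge0_le_integral => //.
- by apply/measurable_EFinP; exact: measurable_abs_powR.
- apply/measurable_EFinP; apply: measurableT_comp => //.
  by apply: measurable_funM => //; exact: normr_measurable.
move=> x _; rewrite lee_fin mul1r.
exact: (le_trans (powR_le1D _) (expR_ge1Dx _)).
Qed.

Lemma gauss1_abs_powR_gt0 : (0 < \int[gauss 1]_x (`|x| `^ p)%:E)%E.
Proof.
rewrite gauss1_abs_powR.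
(* On [[1, 2]] one has [x ^ p >= 1], and the normal density is at least its value at 2. *)
apply: (@lt_le_trans _ _ (\int[mu]_(x in `[1%R, 2%R]) (normal_pdf 0 1 2)%:E)%E).
  rewrite integral_cst//= lebesgue_measure_itv/= lte_fin ltr1n.
  rewrite mule_gt0// ?lte_fin.
    by rewrite normal_pdfE ?oner_neq0// mulr_gt0 ?expR_gt0// normal_peak_gt0 ?oner_neq0.
  by lra.
apply: (@le_trans _ _ (\int[mu]_(x in `[1%R, 2%R]) (h x)%:E)%E).
  apply: ge0_le_integral => //.
  - by move=> x _; rewrite lee_fin normal_pdf_ge0.
  - exact: measurable_funTS.
  move=> x; rewrite /= in_itv/= => /andP[x1 x2]; rewrite lee_fin /h.
  have x0 : 0 <= x by lra.
  rewrite /abs_normal_pdf x0 -[leLHS]mul1r ler_pM ?normal_pdf_ge0//.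
    rewrite -(onepowR p).
    by apply: ge0_ler_powR; rewrite ?nnegrE ?ler01// ltW.
  rewrite -[leLHS]addr0 lerD ?normal_pdf_ge0//.
  rewrite !normal_pdfE ?oner_neq0// ler_pM2l ?normal_peak_gt0 ?oner_neq0//.
  rewrite ler_expR !subr0 expr1n ler_pM2r ?invr_gt0//.
  by rewrite lerN2 lerXn2r ?nnegrE.
apply: ge0_subset_integral => //; first exact: measurable_funTS.
  by move=> x _; rewrite lee_fin.
by move=> x; rewrite /= !in_itv/= andbT => /andP[+ _]; apply: le_trans.
Qed.

(** The integral from 0 to [x] is continuous in [x], vanishes at 0 and tends to a finite [M > 0], so
    it takes the value [M / 2]; the tail beyond that point is the other half. *)
Lemma zstar_exists : exists z : R, is_zstar p z.
Proof.
pose M := fine (\int[gauss 1]_x (`|x| `^ p)%:E)%E.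
have ME : (\int[mu]_(x in `[0%R, +oo[) (h x)%:E = M%:E)%E.
  rewrite -gauss1_abs_powR fineK// ge0_fin_numE ?gauss1_abs_powR_lty//.
  exact/ltW/gauss1_abs_powR_gt0.
have M0 : 0 < M.
  by rewrite fine_gt0// gauss1_abs_powR_gt0 gauss1_abs_powR_lty.
have subint (A : set (measurableTypeR R)) : measurable A -> A `<=` `[0%R, +oo[ ->
    mu.-integrable A (EFin \o h).
  move=> mA A0; apply/integrableP; split; first exact: measurable_funTS.
  under eq_integral do rewrite /= ger0_norm//.
  apply: (@le_lt_trans _ _ M%:E); last exact: ltry.
  rewrite -ME; apply: ge0_subset_integral => //; first exact: measurable_funTS.
  by move=> x _; rewrite lee_fin.
have sub0 (b : R) : `[0, b] `<=` `[0%R, +oo[.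
  by move=> x; rewrite /= !in_itv/= andbT => /andP[].
(* The intermediate value theorem needs a compact interval. If every truncated integral stayed below
   [M / 2], monotone convergence would give [M <= M / 2]. *)
have [b b0 Mb] : exists2 b : R, 0 <= b &
    ((M / 2)%:E <= \int[mu]_(x in `[0%R, b]) (h x)%:E)%E.
  pose F n : set (measurableTypeR R) := `[0, n%:R]%classic.
  have ndF : nondecreasing_seq F.
    move=> m n mn; apply/subsetPset => x; rewrite /F /= !in_itv/=.
    by move=> /andP[-> /le_trans]; apply; rewrite ler_nat.
  have UF : \bigcup_i F i = `[0%R, +oo[%classic.
    apply/seteqP; split => [x [n _]|x]; rewrite /F /= !in_itv/= ?andbT.
      by case/andP.
    move=> x0; exists (Num.truncn x).+1 => //=.
    by rewrite /F /= in_itv/= x0 ltW// truncnS_gt.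
  have cF : (\int[mu]_(x in F i) (h x)%:E @[i --> \oo] --> M%:E)%E.
    rewrite -ME -UF; apply: ge0_nondecreasing_set_cvg_integral => //.
    - by move=> i; exact: measurable_itv.
    - by move=> i; exact: measurable_funTS.
    - by move=> i x _; rewrite lee_fin.
  apply: contrapT => nb.
  suff : (M%:E <= (M / 2)%:E)%E by rewrite lee_fin; lra.
  apply: (cvge_le _ cF); apply: nearW => n.
  rewrite leNgt; apply/negP => /ltW Mn.
  by apply: nb; exists n%:R.
pose Phi x := parameterized_integral mu 0 x h.
have PhiE x : 0 <= x -> (\int[mu]_(t in `[0%R, x]) (h t)%:E = (Phi x)%:E)%E.
  move=> x0; rewrite /Phi /parameterized_integral /Rintegral fineK//.
  by apply: integrable_fin_num => //; exact: subint.
have cPhi : {within `[0, b], continuous Phi}.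
  by apply: parameterized_integral_continuous => //; exact: subint.
have Phi0 : Phi 0 = 0.
  by rewrite /Phi /parameterized_integral set_itv1 Rintegral_set1.
have M2b : M / 2 <= Phi b by rewrite -lee_fin -PhiE.
have [z] : exists2 z, z \in `[0, b] & Phi z = M / 2.
  apply: IVT => //; rewrite Phi0 ge_min le_max M2b orbT andbT.
  by apply/orP; left; lra.
rewrite in_itv/= => /andP[z0 zb] Pz.
exists z; split.
  rewrite lt_neqAle z0 andbT; apply/eqP => zE.
  by move: Pz; rewrite -zE Phi0; lra.
have split : (\int[mu]_(x in `[0%R, +oo[) (h x)%:E =
    (Phi z)%:E + \int[mu]_(x in `[z, +oo[) (h x)%:E)%E.
  rewrite -PhiE// -[X in (_ + X)%E]integral_itv_obnd_cbnd; last exact: measurable_funTS.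
  rewrite -ge0_integral_setU//.
  - congr (integral _ _ _); rewrite -itv_bndbnd_setU// bnd_simp//.
  - exact: measurable_funTS.
  - by move=> x _; rewrite lee_fin.
  - rewrite disj_set2E; apply/eqP; rewrite -subset0 => x []/=.
    by rewrite !in_itv/= andbT ltNge => /andP[_ ->].
move: split; rewrite ME Pz -/(h _).
have : (\int[mu]_(x in `[z, +oo[) (h x)%:E)%E \is a fin_num.
  apply: integrable_fin_num => //; apply: subint => // x.
  by rewrite /= !in_itv/= !andbT; exact: le_trans.
rewrite -/h; case: (integral _ _ _) => // r _ [ME2].
by rewrite -EFinM; congr EFin; lra.
Qed.

Lemma zstarP : is_zstar p (zstar p).
Proof. by have [z zP] := zstar_exists; exact: (xgetPex 0 (ex_intro _ z zP)). Qed.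

End ZStar.

Section RealIntegrands.
Context d (T : measurableType d) (R : realType).
Variable nu : {measure set T -> \bar R}.

Lemma ge0_integral_realD (f g : T -> R) :
  measurable_fun setT f -> measurable_fun setT g ->
  (forall x, 0 <= f x) -> (forall x, 0 <= g x) ->
  (\int[nu]_x (f x + g x)%:E = \int[nu]_x (f x)%:E + \int[nu]_x (g x)%:E)%E.
Proof.
move=> mf mg f0 g0; under eq_integral do rewrite EFinD.
apply: ge0_integralD => //.
- by move=> x _; rewrite lee_fin.
- exact/measurable_EFinP.
- by move=> x _; rewrite lee_fin.
- exact/measurable_EFinP.
Qed.

Lemma ge0_integral_realZl (k : R) (f : T -> R) :
  measurable_fun setT f -> 0 <= k -> (forall x, 0 <= f x) ->
  (\int[nu]_x (k * f x)%:E = k%:E * \int[nu]_x (f x)%:E)%E.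
Proof.
move=> mf k0 f0; under eq_integral do rewrite EFinM.
apply: ge0_integralZl => //.
- exact/measurable_EFinP.
- by move=> x _; rewrite lee_fin.
Qed.
End RealIntegrands.

(** * The mean of the test function at the threshold *)

Section ExpectedGap.
Variables (R : realType) (p : R).
Hypotheses (hp0 : 0 < p) (hp1 : p <= 1).
Local Notation mu := (@lebesgue_measure R).

Let z := zstar p.
Let tau := z `^ p.

Let z0 : 0 < z. Proof. by have [] := zstarP hp0 hp1. Qed.

Lemma gauss1_tail_powR :
  (\int[gauss 1]_x (\1_`]z, +oo[ `|x| * `|x| `^ p)%:E =
   2^-1%:E * \int[gauss 1]_x (`|x| `^ p)%:E)%E.
Proof.
have [_ zE] := zstarP hp0 hp1.
rewrite (gauss1_abs_powR p) -zE.
have mf : measurable_fun setT (fun x : R => (\1_`]z, +oo[ x * x `^ p)%:E).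
  apply/measurable_EFinP; apply: measurable_funM; last exact: measurable_powR.
  exact: measurable_indic.
rewrite (integral_gauss1_abs mf); last first.
  by move=> x; rewrite lee_fin mulr_ge0// powR_ge0.
(* The endpoint has measure zero; the open half-line is used because its complement is the event
   measured by [abs_normal_cdf]. *)
rewrite -integral_itv_obnd_cbnd; last first.
  apply: measurable_funTS; apply/measurable_EFinP; apply: measurable_funM.
    exact: measurable_powR.
  exact: measurable_abs_normal_pdf.
rewrite integral_mkcond [RHS]integral_mkcond; apply: eq_integral => x _.
rewrite !patchE indicE !mem_setE !in_itv/= !andbT.
case: ifPn => x0; case: ifPn => zx; rewrite ?mul0r ?mul0e ?mul1r ?EFinM//.
by move: x0; rewrite (le_trans (ltW z0) (ltW zx)).
Qed.

Lemma gauss1_tail :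
  (\int[gauss 1]_x (\1_`]z, +oo[ `|x|)%:E = (rho_star p)%:E)%E.
Proof.
have -> : (\int[gauss 1]_x (\1_`]z, +oo[ `|x|)%:E =
    \int[gauss 1]_x (\1_(~` [set x : R | (`|x| <= z)%R]) x)%:E)%E.
  apply: eq_integral => x _; congr EFin; rewrite !indicE; congr ((nat_of_bool _)%:R).
  apply/idP/idP; rewrite !inE/= in_itv/= andbT => zx.
    by apply/negP; rewrite -ltNge.
  by rewrite ltNge; apply/negP.
have mB : measurable [set x : R | `|x| <= z].
  rewrite (_ : [set _ | _] = (fun x : R => `|x|) @^-1` `]-oo, z]); last first.
    by apply/seteqP; split => x; rewrite /= in_itv.
  by apply: measurable_preimage => //; exact: normr_measurable.
rewrite integral_indic ?setIT//; last exact: measurableC.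
transitivity (1 - gauss 1 [set x : R | (`|x| <= z)%R])%E.
  exact: (@probability_setC _ _ _ (gauss (1 : R))).
rewrite /rho_star /abs_normal_cdf.
rewrite gaussE EFinB fineK; last first.
  by apply: (@fin_num_measure _ _ _ (normal_prob (0 : R) 1)).
congr (_ - normal_prob 0 1 _)%E.
by apply/seteqP; split => x; rewrite /preimage/= mul1r.
Qed.

(** With [u = |x| ^ p] and [I] the indicator of [|x| > z], one has
    [|u - tau| + u + 2 tau I = 2 I u + tau] pointwise. All terms are nonnegative, so both sides
    integrate termwise, and the choice of [z] makes the integral of [2 I u] equal to that of [u],
    which cancels. *)
Lemma gauss1_dist_powR :
  (\int[gauss 1]_x (`| `|x| `^ p - tau |)%:E = (tau - 2 * tau * rho_star p)%:E)%E.
Proof.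
have tau0 : 0 <= tau by exact: powR_ge0.
have mu_ := measurable_abs_powR p.
have mI : measurable_fun setT (fun x : R => (\1_`]z, +oo[ `|x| : R)).
  apply: (@measurableT_comp _ _ _ _ _ _ (\1_`]z, +oo[ : R -> R)).
    exact: measurable_indic.
  exact: normr_measurable.
have md : measurable_fun setT (fun x : R => `| `|x| `^ p - tau |).
  by apply: measurableT_comp => //; exact: measurable_funB.
have I0 (x : R) : 0 <= \1_`]z, +oo[ `|x| :> R by [].
have u0 (x : R) : 0 <= `|x| `^ p by exact: powR_ge0.
set D := (\int[_]_x _)%E; set M := (\int[gauss 1]_x (`|x| `^ p)%:E)%E.
have Mfin : M \is a fin_num.
  by rewrite ge0_fin_numE ?gauss1_abs_powR_lty// integral_ge0.
have mIu : measurable_fun setT (fun x : R => \1_`]z, +oo[ `|x| * `|x| `^ p).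
  exact: measurable_funM.
have mcI : measurable_fun setT (fun x : R => 2 * tau * \1_`]z, +oo[ `|x|).
  exact: measurable_funM.
have Iu0 (x : R) : 0 <= \1_`]z, +oo[ `|x| * `|x| `^ p by rewrite mulr_ge0.
have cI0 (x : R) : 0 <= 2 * tau * \1_`]z, +oo[ `|x| by rewrite !mulr_ge0.
have EL : (\int[gauss 1]_x (`| `|x| `^ p - tau | +
    (`|x| `^ p + 2 * tau * \1_`]z, +oo[ `|x|))%:E =
    D + (M + (2 * tau)%:E * (rho_star p)%:E))%E.
  rewrite ge0_integral_realD//; last by move=> x; rewrite addr_ge0.
    by rewrite ge0_integral_realD// ge0_integral_realZl ?mulr_ge0// gauss1_tail.
  exact: measurable_funD.
have ER : (\int[gauss 1]_x (2 * (\1_`]z, +oo[ `|x| * `|x| `^ p) + tau)%:E =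
    2%:E * (2^-1%:E * M) + tau%:E)%E.
  rewrite ge0_integral_realD//; last exact: measurable_funM.
  rewrite ge0_integral_realZl// gauss1_tail_powR integral_cst//; congr (_ + _)%E.
  rewrite -[RHS]mule1; congr (_ * _)%E.
  exact: probability_setT.
have E : (D + (M + (2 * tau)%:E * (rho_star p)%:E) =
    2%:E * (2^-1%:E * M) + tau%:E)%E.
  rewrite -EL -ER; apply: eq_integral => x _; congr EFin.
  rewrite indicE mem_setE in_itv/= andbT.
  have [zx|xz] := ltP z `|x|.
    rewrite ger0_norm; first by rewrite mulr1n; lra.
    by rewrite subr_ge0; apply: ge0_ler_powR; rewrite ?nnegrE// ltW.
  rewrite ler0_norm; first by rewrite mulr0n; lra.
  by rewrite subr_le0; apply: ge0_ler_powR; rewrite ?nnegrE// ltW.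
rewrite -(fineK Mfin) -!EFinM in E; move: E.
have D0 : (0 <= D)%E by apply: integral_ge0 => x _; rewrite lee_fin.
move=> E; clear EL; clearbody D; move: D E D0 => [r| |]// + _.
by rewrite -!EFinD => -[E]; congr EFin; lra.
Qed.
End ExpectedGap.

(** * An exponential moment below one *)

Section Chernoff.
Variable R : realType.

(** A second-order bound replaces differentiation under the integral: [expR (l f) <= 1 + l f + 4 l ^
    2 expR (2 |f|)] for [0 < l <= 1]. Of the two factors [expR |f|] on the right, one pays for
    [f ^ 2] and the other for the remainder of the exponential. *)
Lemma chernoff_lt1 d (T : measurableType d) (P : probability T R) (f : T -> R) :
  measurable_fun setT f -> (\int[P]_x (expR (2 * `|f x|))%:E < +oo)%E ->
  (\int[P]_x (f x)%:E < 0)%E ->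
  exists2 l : R, 0 < l & (\int[P]_x (expR (l * f x))%:E < 1)%E.
Proof.
move=> mf; set K' := (\int[P]_x _)%E => Ky; set m' := (\int[P]_x _)%E => m0.
have mexp : measurable_fun setT (fun x => expR (2 * `|f x|)).
  apply: measurableT_comp => //; apply: measurable_funM => //.
  exact: measurableT_comp.
have fle x : `|f x| <= expR (2 * `|f x|).
  have := expR_ge1Dx (2 * `|f x|); have := normr_ge0 (f x); lra.
have intf : P.-integrable setT (EFin \o f).
  apply/integrableP; split; first exact/measurable_EFinP.
  apply: le_lt_trans Ky; apply: ge0_le_integral => //.
  - by apply: measurableT_comp => //; exact/measurable_EFinP.
  - exact/measurable_EFinP.
  - by move=> x _; rewrite lee_fin.
have intK : P.-integrable setT (EFin \o (fun x => expR (2 * `|f x|))).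
  apply/integrableP; split; first exact/measurable_EFinP.
  by under eq_integral do rewrite /= ger0_norm ?expR_ge0//.
have mE : m' = (fine m')%:E by rewrite fineK//; exact: integrable_fin_num.
have KE : K' = (fine K')%:E by rewrite fineK//; exact: integrable_fin_num.
set m := fine m' in mE; set K := fine K' in KE.
have m_lt0 : m < 0 by rewrite -lte_fin -mE.
have K0 : 0 <= K by rewrite -lee_fin -KE integral_ge0// => x _; rewrite lee_fin expR_ge0.
have bnd (l : R) x : 0 < l -> l <= 1 ->
    expR (l * f x) <= 1 + l * f x + 4 * l ^+ 2 * expR (2 * `|f x|).
  move=> l0 l1; set y := l * f x.
  have h2 := expR_ge1Dx y.
  have h1 : expR y * (1 - y) <= 1.
    by have := ler_wpM2l (expR_ge0 y) (expR_ge1Dx (- y)); rewrite expRxMexpNx_1.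
  (* By [h1], [expR y <= 1 + y * expR y]. For [y >= 0] the same bound is used once more on the
     right; for [y < 0], [h2] is. *)
  have ey : expR y <= 1 + y + y ^+ 2 * expR `|y|.
    have [y0|y0] := leP 0 y.
      have : y * (expR y * (1 - y)) <= y * 1 by rewrite ler_wpM2l.
      rewrite ger0_norm//; nra.
    have : y * expR y <= y * (1 + y) by rewrite ler_wnM2l// ltW.
    have : y ^+ 2 * 1 <= y ^+ 2 * expR `|y|.
      by rewrite ler_wpM2l ?sqr_ge0// -expR0 ler_expR.
    nra.
  apply: (le_trans ey); rewrite lerD2l.
  have eh : `|f x| / 2 <= expR (`|f x| / 2).
    by have := expR_ge1Dx (`|f x| / 2); lra.
  have f2 : (f x) ^+ 2 <= 4 * expR `|f x|.
    have -> : expR `|f x| = expR (`|f x| / 2) ^+ 2.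
      by rewrite expr2 -expRD; congr expR; field.
    rewrite -[(f x) ^+ 2]real_normK ?num_real//.
    have : 0 <= `|f x| by []. nra.
  have e2 : expR (2 * `|f x|) = expR `|f x| * expR `|f x|.
    by rewrite -expRD; congr expR; ring.
  have ly : expR `|y| <= expR `|f x|.
    by rewrite ler_expR /y normrM (gtr0_norm l0) ler_piMl.
  rewrite e2 /y exprMn.
  rewrite (_ : 4 * l ^+ 2 * _ = l ^+ 2 * (4 * expR `|f x|) * expR `|f x|); last by ring.
  apply: ler_pM => //; rewrite ?expR_ge0//.
    by rewrite -exprMn sqr_ge0.
  by rewrite ler_wpM2l ?sqr_ge0.
(* This choice gives [8 l ^ 2 K < - l m], so that the quadratic term costs less than half of the
   linear gain; the [+ 1] keeps the denominator positive when [K = 0]. *)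
pose l := Num.min 1 (- m / (8 * K + 1)).
have l0 : 0 < l.
  by rewrite lt_min ltr01/= divr_gt0 ?oppr_gt0//; lra.
have l1 : l <= 1 by rewrite ge_min lexx.
have lK : l * (8 * K + 1) <= - m.
  by rewrite -ler_pdivlMr; [rewrite ge_min lexx orbT|lra].
exists l => //.
apply: (@le_lt_trans _ _ (1 + l * m + 4 * l ^+ 2 * K)%:E); last first.
  rewrite lte_fin; have : 0 <= l * K by rewrite mulr_ge0// ltW.
  nra.
apply: (@le_trans _ _ (\int[P]_x (1 + l * f x + 4 * l ^+ 2 * expR (2 * `|f x|))%:E)%E).
  apply: ge0_le_integral => //.
  - apply/measurable_EFinP; apply: measurableT_comp => //.
    exact: measurable_funM.
  - apply/measurable_EFinP; apply: measurable_funD; last exact: measurable_funM.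
    by apply: measurable_funD => //; exact: measurable_funM.
  - by move=> x _; rewrite lee_fin bnd.
have int1 : P.-integrable setT (fun x => (1 : R)%:E).
  exact: finite_measure_integrable_cst.
have intl : P.-integrable setT (fun x => (l * f x)%:E).
  by apply: eq_integrable (integrableZl measurableT l intf).
have intlK : P.-integrable setT (fun x => (4 * l ^+ 2 * expR (2 * `|f x|))%:E).
  by apply: eq_integrable (integrableZl measurableT (4 * l ^+ 2) intK).
rewrite (eq_integral (fun x => ((1 : R)%:E + (l * f x)%:E) +
    (4 * l ^+ 2 * expR (2 * `|f x|))%:E)%E); last first.
  by move=> x _; rewrite !EFinD.
rewrite integralD//; last exact: integrableD.
rewrite integralD//.
have -> : (\int[P]_x (1 : R)%:E = 1)%E.
  by rewrite integral_cst// mul1e; exact: probability_setT.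
have -> : (\int[P]_x (l * f x)%:E = l%:E * m%:E)%E.
  by rewrite -mE -(integralZl measurableT intf).
have -> : (\int[P]_x (4 * l ^+ 2 * expR (2 * `|f x|))%:E =
    (4 * l ^+ 2)%:E * K%:E)%E.
  by rewrite -KE -(integralZl measurableT intK).
by rewrite !EFinD !EFinM.
Qed.
End Chernoff.

(** * Exponential tails *)

Section Tail.
Variable R : realType.

Lemma gauss1E (B : set R) : gauss 1 B = normal_prob 0 1 B.
Proof.
by rewrite gaussE; congr (normal_prob 0 1 _); apply/funext => x; rewrite /preimage/= mul1r.
Qed.

Lemma iid_std_normal_rows d (Omega : measurableType d) (P : probability Omega R)
    (m n : nat) (A : 'I_m -> 'I_n -> {RV P >-> R}) (B : 'I_m -> 'I_n -> set R) :
  iid_std_normal A -> (forall i j, measurable (B i j)) ->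
  P (\big[setI/setT]_i \big[setI/setT]_j (A i j @^-1` B i j)) =
  (\prod_i \prod_j gauss 1 (B i j))%E.
Proof.
move=> [law indep] mB.
have := indep [set: 'I_m * 'I_n]%SET (fun ij => B ij.1 ij.2) (fun ij => mB ij.1 ij.2).
rewrite (_ : \bigcap_(i in _) _ =
    \big[setI/setT]_i \big[setI/setT]_j (A i j @^-1` B i j)); last first.
  rewrite -bigcap_seq; apply/seteqP; split => w /= Aw.
    move=> i _; rewrite -bigcap_seq => j _; apply: (Aw (i, j)).
    by rewrite /= inE.
  move=> [i j] _ /=; have := Aw i; rewrite /= mem_index_enum => /(_ isT).
  by rewrite -bigcap_seq => /(_ j); rewrite /= mem_index_enum => /(_ isT).
move=> ->; rewrite pair_big; apply: eq_big => [ij|ij _]; first by rewrite inE.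
by rewrite gauss1E -(law ij.1 ij.2).
Qed.

(** The indicator of the event is at most [expR (l S)], with [S] the sum, and the mean of that
    exponential is [theta ^ m] for [theta] the mean of [expR (l f)]. Since [z] enters only through
    the law of the rows, one [theta] serves all dimensions and all unit vectors. *)
Lemma gauss1_tail_bound (a : R) (f : R -> R) :
  measurable_fun setT f -> (forall x, `|f x| <= a + `|x|) ->
  (\int[gauss 1]_x (f x)%:E < 0)%E ->
  exists2 theta : R, 0 <= theta < 1 &
  forall d (Omega : measurableType d) (P : probability Omega R) (m n : nat)
    (A : 'I_m -> 'I_n -> {RV P >-> R}) (z : 'I_n -> R),
  iid_std_normal A -> \sum_j z j ^+ 2 = 1 ->
  (P [set w | (0 <= \sum_i f (\sum_j z j * A i j w))%R] <= (theta ^+ m)%:E)%E.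
Proof.
move=> mf fa f0.
have mexpa (c : R) : measurable_fun setT (fun x : R => expR (c * `|x|)).
  by apply: measurableT_comp => //; apply: measurable_funM => //; exact: normr_measurable.
have Ky : (\int[gauss 1]_x (expR (2 * `|f x|))%:E < +oo)%E.
  apply: (@le_lt_trans _ _ (\int[gauss 1]_x (expR (2 * a) * expR (2 * `|x|))%:E)%E).
    apply: ge0_le_integral => //.
    - apply/measurable_EFinP; apply: measurableT_comp => //.
      by apply: measurable_funM => //; exact: measurableT_comp.
    - by apply/measurable_EFinP; exact: measurable_funM.
    - by move=> x _; rewrite lee_fin -expRD ler_expR -mulrDr ler_pM2l.
  rewrite ge0_integral_realZl// ?expR_ge0//.
  by rewrite lte_mul_pinfty ?lee_fin ?expR_ge0//; exact: gauss1_exp_abs.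
have [l l0 Gl] := chernoff_lt1 mf Ky f0.
pose G x := expR (l * f x).
have mG : measurable_fun setT G.
  by apply: measurableT_comp => //; exact: measurable_funM.
have G0 x : 0 <= G x by exact: expR_ge0.
set th := (\int[_]_x _)%E in Gl.
have th0 : (0 <= th)%E by apply: integral_ge0 => x _; rewrite lee_fin.
have thfin : th \is a fin_num.
  rewrite (ge0_fin_numE th0); exact: (lt_trans Gl (ltry 1)).
have thE : th = (fine th)%:E by rewrite (fineK thfin).
exists (fine th); first by rewrite -!lte_fin -lee_fin -thE th0.
move=> d Omega P m n A z iidA z1.
have mY i : measurable_fun setT (fun w => \sum_j z j * A i j w).
  by apply: measurable_sum => j; exact: measurable_funM.
have mS : measurable_fun setT (fun w => \sum_i f (\sum_j z j * A i j w)).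
  by apply: measurable_sum => i; exact: (measurableT_comp mf).
have mPG : measurable_fun setT (fun w => 1 * \prod_i G (\sum_j z j * A i j w)).
  apply: measurable_funM => //; apply: measurable_prod => i _.
  exact: (measurableT_comp mG).
set B := [set w | _].
have mB : measurable B.
  rewrite (_ : B = (fun w => \sum_i f (\sum_j z j * A i j w)) @^-1` `[0, +oo[).
    exact: measurable_preimage.
  by apply/seteqP; split => w; rewrite /B/= in_itv/= andbT.
have -> : (fine th ^+ m)%:E =
    (\int[P]_w (1 * \prod_i G (\sum_j z j * A i j w))%:E)%E.
  have := @integral_prod_rows _ Omega R P 'I_m 'I_n A z (index_enum 'I_m)
    (index_enum 'I_n) G (cst 1) (index_enum_uniq _) (index_enum_uniq _) z1 mG G0.
  move=> ->//; last first.
    move=> A0 BX mA0 mBX; rewrite -(iid_std_normal_rows iidA mBX) preimage_cst.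
    case: ifPn => _; last by rewrite set0I measure0 mul0e.
    by rewrite setTI probability_setT mul1e.
  have -> : (\int[P]_w (cst (1 : R) w)%:E = 1)%E.
    transitivity (\int[P]_w (cst 1%:E w))%E; first exact: eq_integral.
    by rewrite integral_cst// mul1e; exact: probability_setT.
  by rewrite mul1e -/th thE prodEFin prodr_const card_ord.
have -> : P B = (\int[P]_w (\1_B w)%:E)%E by rewrite integral_indic// setIT.
apply: ge0_le_integral => //.
- exact/measurable_EFinP.
- exact/measurable_EFinP.
move=> w _; rewrite lee_fin mul1r indicE.
case: (boolP (w \in B)) => wB; last exact: prodr_ge0.
rewrite -expR_sum -expR0 ler_expR -mulr_sumr.
by apply: mulr_ge0; [exact: ltW|move/set_mem : wB].
Qed.
End Tail.

(** * Deterministic reduction to a net *)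

Section Deterministic.
Variable R : realType.

(** For [p <= 1] a number in [[0, 1]] is at most its [p]-th power; this is applied to the shares
    [x / (x + y)] and [y / (x + y)], which add up to 1. *)
Lemma powR_subadd (p x y : R) : 0 < p -> p <= 1 -> 0 <= x -> 0 <= y ->
  (x + y) `^ p <= x `^ p + y `^ p.
Proof.
move=> p0 p1 x0 y0.
have [s0|s0] := eqVneq (x + y) 0.
  by rewrite s0 powR0 ?gt_eqF// addr_ge0 ?powR_ge0.
have sp : 0 < x + y by rewrite lt_def s0 addr_ge0.
have frac a b : 0 <= a -> 0 <= b -> a + b = x + y ->
    a / (x + y) * (x + y) `^ p <= a `^ p.
  move=> a0 b0 ab; have [->|an0] := eqVneq a 0.
    by rewrite !mul0r powR_ge0.
  have ap : 0 < a by rewrite lt_def an0.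
  rewrite -[in leRHS](divfK s0 a) powRM ?divr_ge0 ?(ltW sp)//.
  rewrite ler_pM2r ?powR_gt0//; apply: ger1_powR => //.
  by rewrite divr_gt0//= ler_pdivrMr// mul1r -ab lerDl.
have : (x + y) `^ p = x / (x + y) * (x + y) `^ p + y / (x + y) * (x + y) `^ p.
  by rewrite -mulrDl -mulrDl divff// mul1r.
by move=> ->; apply: lerD; [exact: (frac x y)|apply: (frac y x) => //; rewrite addrC].
Qed.

Lemma powR_norm_dist (p x y : R) : 0 < p -> p <= 1 ->
  `| `|x| `^ p - `|y| `^ p | <= `|x - y| `^ p.
Proof.
move=> p0 p1.
have H (a b : R) : `|a| `^ p - `|b| `^ p <= `|a - b| `^ p.
  rewrite lerBlDr; apply: (@le_trans _ _ ((`|a - b| + `|b|) `^ p)).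
    apply: ge0_ler_powR; rewrite ?nnegrE ?addr_ge0 ?(ltW p0)//.
    by rewrite -[X in `|X| <= _](subrK b) ler_normD.
  exact: powR_subadd.
by rewrite ler_norml lerNl opprB {1}distrC !H.
Qed.

(* The scale [c] makes it enough to check the gap on unit vectors. *)
Lemma lp_corrects_of_gap (p rho tau : R) (m n : nat) (A : 'M[R]_(m, n)) :
  0 < p -> p <= 1 -> 0 <= tau ->
  (forall h : 'cV[R]_n, h != 0 ->
     exists2 c : R, 0 < c &
       \sum_i (`| `|(A *m h) i 0| `^ p - c * tau| +
               (2 * rho - 1) * (c * tau)) < 0) ->
  lp_corrects p rho A.
Proof.
move=> p0 p1 t0 gap f e supple /=.
set y := A *m f + e.
have yA x : y - A *m x = e - A *m (x - f).
  by rewrite /y mulmxBr opprB [A *m f + e]addrC -addrA.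
have strict x : x != f -> normpp p (y - A *m f) < normpp p (y - A *m x).
  move=> xf; rewrite !yA subrr mulmx0 subr0.
  have h0 : x - f != 0 by rewrite subr_eq0.
  have [c c0 gapc] := gap _ h0.
  set v := A *m (x - f) in gapc *.
  pose u i := `|v i 0| `^ p; pose t := c * tau.
  (* On the support this is the reverse triangle inequality for [p]-th powers; off it [e i 0 = 0]
     and equality holds. *)
  have term i : `|e i 0| `^ p + (if i \in supp e then - u i else u i) <=
      `|(e - v) i 0| `^ p.
    have -> : (e - v) i 0 = e i 0 - v i 0 by rewrite mxE [in LHS]mxE.
    case: ifPn => [_|].
      have := powR_norm_dist (e i 0) (v i 0) p0 p1; rewrite ler_norml => /andP[_].
      exact.
    by rewrite inE negbK => /eqP ->; rewrite normr0 powR0 ?gt_eqF// add0r sub0r normrN.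
  apply: (@lt_le_trans _ _ (\sum_i (`|e i 0| `^ p +
    (if i \in supp e then - u i else u i)))); last exact: ler_sum.
  rewrite big_split/= ltrDl.
  have t0' : 0 <= t by rewrite mulr_ge0// ltW.
  (* [sum_(supp e) u - sum_(~ supp e) u] is at most
     [sum |u - t| + (2 #|supp e| - m) t] *)
  suff : - \sum_i (if i \in supp e then - u i else u i) <=
      \sum_i (`|u i - t| + (2 * rho - 1) * t).
    by move=> /le_lt_trans/(_ gapc); rewrite oppr_lt0.
  rewrite -sumrN.
  apply: (@le_trans _ _ (\sum_i (`|u i - t| + (if i \in supp e then t else - t)))).
    apply: ler_sum => i _; case: ifPn => _.
      by rewrite opprK -lerBlDr ler_norm.
    by rewrite lerBrDr addrC -[leLHS]opprB opprB distrC ler_norm.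
  rewrite !big_split/= lerD2l sumr_const card_ord.
  rewrite (bigID (mem (supp e)))/=.
  rewrite (eq_bigr (fun=> t)); last by move=> i ->.
  rewrite [X in _ + X](eq_bigr (fun=> - t)); last by move=> i /negbTE ->.
  rewrite !sumr_const.
  have cE : (#|supp e| + #|[predC supp e]|)%N = m by rewrite cardC card_ord.
  have cR : #|[predC supp e]|%:R = m%:R - #|supp e|%:R :> R.
    by apply/eqP; rewrite eq_sym subr_eq -natrD addnC cE.
  have -> : t *+ #|supp e| + (- t) *+ #|[predC supp e]| =
      t * (2 * #|supp e|%:R - m%:R).
    by rewrite -[t *+ _]mulr_natr -[(- t) *+ _]mulr_natr cR; ring.
  rewrite -[leRHS]mulr_natr -mulrA mulrCA ler_wpM2l//.
  by rewrite mulrBl mul1r lerD2r -mulrA ler_pM2l.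
split.
  by move=> x; have [->//|xf] := eqVneq x f; exact/ltW/strict.
move=> x xmin; apply/eqP; apply: contraT => xf.
by have := strict x; rewrite eq_sym xf => /(_ isT); rewrite ltNge xmin.
Qed.
End Deterministic.

(** * From a net to the whole sphere *)

Section NetArgument.
Variable R : realType.

Definition sqnorm n (z : 'cV[R]_n) : R := \sum_j z j 0 ^+ 2.

Lemma sqnorm_ge0 n (z : 'cV[R]_n) : 0 <= sqnorm z.
Proof. by apply: sumr_ge0 => j _; exact: sqr_ge0. Qed.

Lemma sqnormZ n (s : R) (z : 'cV[R]_n) : sqnorm (s *: z) = s ^+ 2 * sqnorm z.
Proof.
by rewrite /sqnorm mulr_sumr; apply: eq_bigr => j _; rewrite mxE exprMn.
Qed.

Lemma sqnorm_eq0 n (z : 'cV[R]_n) : (sqnorm z == 0) = (z == 0).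
Proof.
apply/idP/eqP => [|->]; last first.
  by rewrite /sqnorm big1// => j _; rewrite mxE expr0n.
rewrite psumr_eq0 => [/allP z0|j _]; last exact: sqr_ge0.
apply/colP => j; rewrite mxE; apply/eqP.
by rewrite -sqrf_eq0; exact/z0/mem_index_enum.
Qed.

Lemma normalize n (h : 'cV[R]_n) : h != 0 ->
  let s := Num.sqrt (sqnorm h) in
  [/\ 0 < s, sqnorm (s^-1 *: h) = 1 & h = s *: (s^-1 *: h)].
Proof.
move=> h0 s.
have h2 : 0 < sqnorm h by rewrite lt_def sqnorm_eq0 h0 sqnorm_ge0.
have s0 : 0 < s by rewrite sqrtr_gt0.
split => //; last by rewrite scalerA divff ?scale1r// gt_eqF.
by rewrite sqnormZ exprVn sqr_sqrtr ?ltW// mulVf// gt_eqF.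
Qed.

Variables (p : R) (hp0 : 0 < p) (hp1 : p <= 1).

Lemma normpp_ge0 k (v : 'cV[R]_k) : 0 <= normpp p v.
Proof. by apply: sumr_ge0 => i _; exact: powR_ge0. Qed.

Lemma normpp0 k : normpp p (0 : 'cV[R]_k) = 0.
Proof. by rewrite /normpp big1// => i _; rewrite mxE normr0 powR0 ?gt_eqF. Qed.

Lemma normppZ k (s : R) (v : 'cV[R]_k) : normpp p (s *: v) = `|s| `^ p * normpp p v.
Proof.
by rewrite /normpp mulr_sumr; apply: eq_bigr => i _; rewrite mxE normrM powRM.
Qed.

Lemma normppD k (v w : 'cV[R]_k) : normpp p (v + w) <= normpp p v + normpp p w.
Proof.
rewrite /normpp -big_split; apply: ler_sum => i _; rewrite mxE /=.
apply: le_trans (powR_subadd hp0 hp1 _ _) => //.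
by apply: ge0_ler_powR; rewrite ?nnegrE ?(ltW hp0) ?addr_ge0 ?ler_normD.
Qed.

Variables (m n : nat) (A : 'M[R]_(m, n)).

Lemma normpp_small (M eps : R) (h : 'cV[R]_n) : 0 <= M -> 0 <= eps ->
  (forall z, sqnorm z = 1 -> normpp p (A *m z) <= M) ->
  sqnorm h <= eps ^+ 2 -> normpp p (A *m h) <= eps `^ p * M.
Proof.
move=> M0 e0 AM he; have [->|h0] := eqVneq h 0.
  by rewrite mulmx0 normpp0 mulr_ge0 ?powR_ge0.
have [s0 z1 ->] := normalize h0; set s := Num.sqrt _ in s0 z1 *.
rewrite -scalemxAr normppZ ler_pM ?powR_ge0 ?normpp_ge0 ?AM// gtr0_norm//.
apply: ge0_ler_powR; rewrite ?nnegrE ?(ltW hp0) ?(ltW s0)//.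
by rewrite -(ger0_norm e0) -sqrtr_sqr ler_sqrt// sqr_ge0.
Qed.

Variables (N : seq 'cV[R]_n) (eps K : R).
Hypotheses (eps0 : 0 <= eps) (epsp : eps `^ p <= 2^-1) (K0 : 0 <= K).
Hypothesis netP : forall z : 'cV[R]_n, sqnorm z = 1 ->
  exists2 v, v \in N & sqnorm (z - v) <= eps ^+ 2.
Hypothesis NK : forall v, v \in N -> normpp p (A *m v) <= K.

(* The supremum [M] over the unit sphere satisfies [M <= K + eps^p M], and it is
   finite. *)
Lemma normpp_sphere (z : 'cV[R]_n) : sqnorm z = 1 -> normpp p (A *m z) <= 2 * K.
Proof.
move=> z1; pose E := [set normpp p (A *m v) | v in [set v : 'cV[R]_n | sqnorm v = 1]].
have supE : has_sup E.
  split; first by exists (normpp p (A *m z)), z.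
  (* The coordinates of a unit vector are at most 1 in absolute value. This bound depends on [A] and
     only serves to make the supremum finite. *)
  exists (\sum_i (\sum_j `|A i j|) `^ p) => _ [v /= v1 <-].
  apply: ler_sum => i _; apply: ge0_ler_powR; rewrite ?nnegrE ?(ltW hp0) ?sumr_ge0//.
  rewrite mxE (le_trans (ler_norm_sum _ _ _))//; apply: ler_sum => j _.
  rewrite normrM ler_piMr//.
  have : v j 0 ^+ 2 <= 1.
    rewrite -v1 /sqnorm (bigD1 j)//= lerDl sumr_ge0// => k _; exact: sqr_ge0.
  by rewrite -[_ ^+ 2]real_normK ?num_real// expr_le1.
have ubE v : sqnorm v = 1 -> normpp p (A *m v) <= sup E.
  by move=> v1; apply: ub_le_sup; [case: supE|exists v].
have M0 : 0 <= sup E by apply: le_trans (ubE _ z1); exact: normpp_ge0.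
suff : sup E <= K + 2^-1 * sup E by have := ubE _ z1; lra.
apply: ge_sup; first by case: supE.
move=> _ [v /= v1 <-]; have [u uN vu] := netP v1.
rewrite -(subrK u v) addrC mulmxDr; apply: (le_trans (normppD _ _)).
apply: lerD; first exact: NK.
apply: (le_trans (normpp_small M0 eps0 ubE vu)).
by rewrite ler_wpM2r.
Qed.

Lemma gap_of_net (rho tau del : R) : 0 <= tau ->
  (forall v, v \in N ->
     \sum_i (`| `|(A *m v) i 0| `^ p - tau| + (2 * rho - 1) * tau) <= - del) ->
  eps `^ p * (2 * K) < del ->
  lp_corrects p rho A.
Proof.
move=> t0 Ndel edel; apply: (lp_corrects_of_gap hp0 hp1 t0) => h h0.
have [s0 z1 hE] := normalize h0; set s := Num.sqrt _ in s0 z1 hE *.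
set z := s^-1 *: h in z1 hE.
(* With [tau] scaled by [s ^ p] as well, the sum for [h = s z] is [s ^ p] times the sum for the unit
   vector [z]. *)
exists (s `^ p); first exact: powR_gt0.
have -> : \sum_i (`| `|(A *m h) i 0| `^ p - s `^ p * tau| +
      (2 * rho - 1) * (s `^ p * tau)) =
    s `^ p * \sum_i (`| `|(A *m z) i 0| `^ p - tau| + (2 * rho - 1) * tau).
  rewrite mulr_sumr; apply: eq_bigr => i _.
  rewrite hE -scalemxAr mxE normrM (gtr0_norm s0) powRM// ?(ltW s0)//.
  by rewrite -mulrBr normrM (ger0_norm (powR_ge0 _ _)) mulrDr; congr (_ + _); rewrite mulrCA.
rewrite pmulr_rlt0 ?powR_gt0//.
have [v vN zv] := netP z1.
apply: (@le_lt_trans _ _ (- del + eps `^ p * (2 * K))); last by lra.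
apply: (@le_trans _ _ (\sum_i (`| `|(A *m v) i 0| `^ p - tau| + (2 * rho - 1) * tau)
    + normpp p (A *m (z - v)))).
  rewrite /normpp -big_split; apply: ler_sum => i _ /=.
  rewrite addrAC lerD2r.
  have := powR_norm_dist ((A *m z) i 0) ((A *m v) i 0) hp0 hp1.
  rewrite (_ : (A *m (z - v)) i 0 = (A *m z) i 0 - (A *m v) i 0); last first.
    by rewrite mulmxBr [LHS]mxE; congr (_ + _); rewrite mxE.
  have := ler_normD (`|(A *m z) i 0| `^ p - `|(A *m v) i 0| `^ p)
    (`|(A *m v) i 0| `^ p - tau).
  by rewrite subrKA; lra.
apply: lerD; first exact: Ndel.
apply: (normpp_small _ eps0 normpp_sphere zv).
by rewrite mulr_ge0.
Qed.
End NetArgument.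

(** * Nets of exponential size on the sphere *)

Section SphereNet.
Variable R : realType.

Lemma sum_half_pow_le2 k : \sum_(i < k) (2^-1 : R) ^+ i <= 2.
Proof.
suff -> : \sum_(i < k) (2^-1 : R) ^+ i = 2 - 2 * 2^-1 ^+ k.
  by rewrite gerBl mulr_ge0// exprn_ge0.
elim: k => [|k IH]; first by rewrite big_ord0 expr0; lra.
by rewrite big_ord_recr/= IH exprS; lra.
Qed.

(** Codes for cells of the sphere: a sign and a rounded magnitude for each coordinate. Capping each
    magnitude at [B] makes the type finite and excludes nothing, as the total is at most [B]. *)
Definition bounded_sums (n B : nat) : {set {ffun 'I_n -> bool * 'I_B.+1}} :=
  [set k : {ffun 'I_n -> bool * 'I_B.+1} | (\sum_j (k j).2 <= B)%N]%SET.

(* Weight a vector of signed magnitudes by [2 ^ - (sum of the magnitudes)]. *)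
Lemma card_bounded_sum (n B : nat) :
  #|bounded_sums n B|%:R <= 2 ^+ B * 4 ^+ n :> R.
Proof.
set K := bounded_sums n B.
pose w (c : bool * 'I_B.+1) : R := 2^-1 ^+ c.2.
have wge (k : {ffun 'I_n -> bool * 'I_B.+1}) : k \in K -> 1 <= 2 ^+ B * \prod_j w (k j).
  rewrite inE => kB; rewrite /w.
  have -> : \prod_j (2^-1 : R) ^+ (k j).2 = 2^-1 ^+ (\sum_j (k j).2).
    by elim/big_rec2 : _ => // j x y _ ->; rewrite exprD.
  rewrite -[B in 2 ^+ B](subnK kB) exprD -mulrA -exprMn divff// expr1n mulr1.
  by rewrite exprn_ege1// ler1n.
apply: (@le_trans _ _ (\sum_(k in K) 2 ^+ B * \prod_j w (k j))).
  by rewrite -sumr_const; exact: ler_sum.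
rewrite -mulr_sumr ler_wpM2l ?exprn_ge0//.
apply: (@le_trans _ _ (\sum_(k : {ffun 'I_n -> bool * 'I_B.+1}) \prod_j w (k j))).
  rewrite [leRHS](bigID (mem K))/= lerDl; apply: sumr_ge0 => k _.
  by apply: prodr_ge0 => j _; rewrite exprn_ge0.
(* The sum over all codes factors over the coordinates; each factor is two signs times a geometric
   sum of at most 2. *)
rewrite -(bigA_distr_bigA (fun _ : 'I_n => w)) prodr_const card_ord.
rewrite lerXn2r ?nnegrE ?sumr_ge0//.
  by move=> c _; rewrite exprn_ge0.
rewrite -(pair_bigA _ (fun (b : bool) (i : 'I_B.+1) => w (b, i)))/= big_bool/=.
by have := sum_half_pow_le2 B.+1; rewrite /w/=; lra.
Qed.

(** Coordinates are rounded towards 0 to multiples of [eps / sqrt n], so vectors of one cell differ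
    by at most [eps] in norm. The absolute coordinates of a unit vector sum to at most [sqrt n], so
    its rounded magnitudes total at most [n / eps <= L n], and [card_bounded_sum] counts the
    cells. *)
Lemma sphere_net (eps : R) : 0 < eps ->
  exists2 D : R, 0 < D & forall n, exists N : seq 'cV[R]_n,
  [/\ (size N)%:R <= D ^+ n,
      (forall v, v \in N -> sqnorm v = 1) &
      forall z : 'cV[R]_n, sqnorm z = 1 ->
        exists2 v, v \in N & sqnorm (z - v) <= eps ^+ 2].
Proof.
move=> e0; pose L := (Num.truncn eps^-1).+1.
have eL : eps^-1 <= L%:R by rewrite ltW// truncnS_gt.
exists (2 ^+ L * 4); first by rewrite mulr_gt0// exprn_gt0.
move=> n; pose c : R := Num.sqrt n%:R / eps; pose B := (L * n)%N.
have c0 : 0 <= c by rewrite divr_ge0 ?sqrtr_ge0// ltW.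
pose mag (z : 'cV[R]_n) j := Num.truncn (`|z j 0| * c).
pose cell (z : 'cV[R]_n) : {ffun 'I_n -> bool * 'I_B.+1} :=
  [ffun j => (0 <= z j 0, inord (mag z j))].
have sumB z : sqnorm z = 1 -> (\sum_j mag z j <= B)%N.
  move=> z1; rewrite -(ler_nat R) natr_sum.
  apply: (@le_trans _ _ (\sum_j ((n%:R * z j 0 ^+ 2 + 1) / 2 / eps))).
    apply: ler_sum => j _; apply: (@le_trans _ _ (`|z j 0| * c)).
      by rewrite truncn_le// mulr_ge0.
    rewrite /c mulrA ler_pM2r ?invr_gt0//.
    (* Coordinatewise [sqrt n |z_j| <= (n z_j ^ 2 + 1) / 2]; the right-hand sides add up to [n] on
       the sphere. *)
    have : 0 <= (Num.sqrt n%:R * `|z j 0| - 1) ^+ 2 by exact: sqr_ge0.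
    rewrite -[z j 0 ^+ 2]real_normK ?num_real// -[in X in _ -> _ <= X](@sqr_sqrtr _ n%:R)//.
    nra.
  rewrite -!mulr_suml big_split/= -mulr_sumr -/(sqnorm z) z1 sumr_const card_ord.
  rewrite mulr1 -[1 *+ n]/(n%:R) /B natrM.
  rewrite (_ : (_ + _) / 2 = n%:R); last by lra.
  by rewrite mulrC ler_wpM2r.
have magB z j : sqnorm z = 1 -> (mag z j < B.+1)%N.
  move=> /sumB zB; rewrite ltnS (leq_trans _ zB)//.
  by rewrite (bigD1 j)//= leq_addr.
pose K := bounded_sums n B.
pose Q k := [set z : 'cV[R]_n | sqnorm z = 1 /\ cell z = k].
(* One unit vector is chosen in each nonempty cell, so the net lies on the sphere itself, where the
   tail bounds apply; the default 0 is never taken. *)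
pose N := [seq xget 0 (Q k) | k <- enum K & `[< Q k !=set0 >]].
have Qk k : `[< Q k !=set0 >] -> Q k (xget 0 (Q k)).
  by move=> /asboolP[z Qz]; exact: (xgetPex 0 (ex_intro _ z Qz)).
exists N; split.
- rewrite exprMn -exprM -/B; apply: le_trans (card_bounded_sum n B).
  by rewrite ler_nat size_map size_filter (leq_trans (count_size _ _))// -cardE.
- by move=> v /mapP[k]; rewrite mem_filter => /andP[/Qk[]] + _ _ ->.
move=> z z1; pose k := cell z.
have kQ : `[< Q k !=set0 >] by apply/asboolP; exists z.
have kK : k \in K.
  rewrite inE (eq_bigr (mag z)) ?sumB// => j _.
  by rewrite ffunE/= inordK// magB.
exists (xget 0 (Q k)).
  by apply/mapP; exists k => //; rewrite mem_filter kQ mem_enum.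
have [v1 cv] := Qk _ kQ; set v := xget _ _ in v1 cv *.
apply: (@le_trans _ _ (\sum_(j < n) eps ^+ 2 / n%:R)); last first.
  rewrite sumr_const card_ord -[(_ / _) *+ n]mulr_natr.
  have [->|n0] := eqVneq n 0%N; first by rewrite mulr0 sqr_ge0.
  by rewrite divfK// pnatr_eq0.
apply: ler_sum => j _; rewrite 2!mxE.
have n0 : 0 < n%:R :> R by rewrite ltr0n (leq_ltn_trans _ (ltn_ord j)).
have cp : 0 < c by rewrite divr_gt0// sqrtr_gt0.
have : cell v j = cell z j by rewrite cv.
rewrite !ffunE => -[sgn /(congr1 val)/=]; rewrite !inordK ?magB// => mvz.
have := truncn_itv (mulr_ge0 (normr_ge0 (v j 0)) c0).
have := truncn_itv (mulr_ge0 (normr_ge0 (z j 0)) c0).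
rewrite -/(mag v j) -/(mag z j) mvz => /andP[z_lo z_hi] /andP[v_lo v_hi].
have dc : `|z j 0 - v j 0| * c <= 1.
  have -> : `|z j 0 - v j 0| = `| `|z j 0| - `|v j 0| |.
    have [z0|z0] := leP 0 (z j 0).
      have v0 : 0 <= v j 0 by rewrite sgn.
      by rewrite (ger0_norm z0) (ger0_norm v0).
    have v0 : v j 0 < 0 by rewrite ltNge sgn -ltNge.
    by rewrite (ltr0_norm z0) (ltr0_norm v0) -opprD normrN.
  rewrite -[c in leLHS]ger0_norm// -normrM mulrBl ler_norml.
  move: z_hi v_hi; rewrite -!natr1; lra.
rewrite -[leLHS]real_normK ?num_real// -[eps ^+ 2 / _](_ : c^-1 ^+ 2 = _); last first.
  by rewrite /c invfM invrK exprMn exprVn sqr_sqrtr// mulrC.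
rewrite lerXn2r ?nnegrE ?invr_ge0//.
by rewrite -[leRHS]mul1r ler_pdivlMr.
Qed.
End SphereNet.

(** * Union bound *)

Section UniformTails.
Variable R : realType.

Lemma probability_bigsetU_le d (T : measurableType d) (P : probability T R)
    (I : eqType) (s : seq I) (F : I -> set T) (q : R) :
  (forall i, measurable (F i)) ->
  (forall i, i \in s -> (P (F i) <= q%:E)%E) ->
  (P (\big[setU/set0]_(i <- s) F i) <= ((size s)%:R * q)%:E)%E.
Proof.
move=> mF; elim: s => [|i s IH] Fq; first by rewrite big_nil measure0 mul0r.
rewrite big_cons /= -natr1 mulrDl mul1r [in leRHS]addrC EFinD.
have mU : measurable (\big[setU/set0]_(j <- s) F j) by exact: bigsetU_measurable.
apply: (@le_trans _ _ (P (F i) + P (\big[setU/set0]_(j <- s) F j))%E).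
  exact: measureU2.
apply: leeD; first by rewrite Fq// mem_head.
by apply: IH => j js; rewrite Fq// in_cons js orbT.
Qed.

Variables (p rho : R).
Hypotheses (hp0 : 0 < p) (hp1 : p <= 1) (hrho : rho < rho_star p).

Let tau := zstar p `^ p.
Let del := (rho_star p - rho) * tau.
(* The additional [1] turns [E |g| ^ p <= K] into a strict inequality. *)
Let K := fine (\int[gauss 1]_x (`|x| `^ p)%:E)%E + 1.

Let tau0 : 0 < tau.
Proof. by apply: powR_gt0; have [] := zstarP hp0 hp1. Qed.

Let del0 : 0 < del.
Proof. by rewrite mulr_gt0// subr_gt0. Qed.

Let K0 : 0 < K.
Proof.
by rewrite ltr_wpDl// fine_ge0// integral_ge0// => x _; rewrite lee_fin powR_ge0.
Qed.

Let f1 (x : R) : R := `| `|x| `^ p - tau| + (2 * rho - 1) * tau + del.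
Let f2 (x : R) : R := `|x| `^ p - K.

Let mf2 : measurable_fun setT f2.
Proof. by apply: measurable_funB => //; exact: measurable_abs_powR. Qed.

Let md : measurable_fun setT (fun x : R => `| `|x| `^ p - tau|).
Proof.
by apply: measurableT_comp => //; apply: measurable_funB => //; exact: measurable_abs_powR.
Qed.

Let mf1 : measurable_fun setT f1.
Proof. by apply: measurable_funD => //; exact: measurable_funD. Qed.

Let f1_bound x : `|f1 x| <= (1 + tau + `|(2 * rho - 1) * tau + del|) + `|x|.
Proof.
rewrite /f1 -addrA; apply: (le_trans (ler_normD _ _)).
rewrite normr_id addrAC lerD2r.
apply: (le_trans (ler_normB _ _)).
rewrite (ger0_norm (powR_ge0 _ _)) (gtr0_norm tau0).
by have := powR_le1D hp0 hp1 (normr_ge0 x); lra.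
Qed.

Let f2_bound x : `|f2 x| <= (1 + K) + `|x|.
Proof.
apply: (le_trans (ler_normB _ _)).
rewrite (ger0_norm (powR_ge0 _ _)) (gtr0_norm K0).
by have := powR_le1D hp0 hp1 (normr_ge0 x); lra.
Qed.

Lemma gauss1_shift (g : R -> R) (c b : R) :
  measurable_fun setT g -> (forall x, 0 <= g x) ->
  (\int[gauss 1]_x (g x)%:E = c%:E)%E ->
  (\int[gauss 1]_x (g x + b)%:E = (c + b)%:E)%E.
Proof.
move=> mg g0 gc; under eq_integral do rewrite EFinD.
have ig : (gauss 1).-integrable setT (fun x : R => (g x)%:E).
  apply/integrableP; split; first exact/measurable_EFinP.
  under eq_integral do rewrite /= ger0_norm//.
  by rewrite gc ltry.
rewrite integralD//; last exact: finite_measure_integrable_cst.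
rewrite EFinD; congr (_ + _)%E => //.
transitivity (\int[gauss 1]_x (cst b%:E x))%E; first exact: eq_integral.
rewrite integral_cst// -[RHS]mule1; congr (_ * _)%E; exact: probability_setT.
Qed.

Let f1_neg : (\int[gauss 1]_x (f1 x)%:E < 0)%E.
Proof.
rewrite (_ : (\int[gauss 1]_x (f1 x)%:E)%E =
    (\int[gauss 1]_x (`| `|x| `^ p - tau| + ((2 * rho - 1) * tau + del))%:E)%E); last first.
  by apply: eq_integral => x _; rewrite /f1 addrA.
rewrite (gauss1_shift _ md (fun=> normr_ge0 _) (gauss1_dist_powR hp0 hp1)) lte_fin.
by have := del0; rewrite -/tau /del; lra.
Qed.

Let f2_neg : (\int[gauss 1]_x (f2 x)%:E < 0)%E.
Proof.
have fE : (\int[gauss 1]_x (`|x| `^ p)%:E = (K - 1)%:E)%E.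
  rewrite /K addrK fineK// ge0_fin_numE ?gauss1_abs_powR_lty//.
  by apply: integral_ge0 => x _; rewrite lee_fin powR_ge0.
rewrite /f2 (gauss1_shift _ (measurable_abs_powR p) (fun=> powR_ge0 _ _) fE).
by rewrite lte_fin; lra.
Qed.

(* [psi] has mean [- 2 del]; adding [del] keeps the mean negative. *)
Lemma uniform_tails : exists t dl k th : R,
  [/\ 0 < t, 0 < dl, 0 < k, 0 < th < 1 &
  forall d (Omega : measurableType d) (P : probability Omega R) (m n : nat)
    (A : 'I_m -> 'I_n -> {RV P >-> R}) (z : 'I_n -> R),
  iid_std_normal A -> \sum_j z j ^+ 2 = 1 ->
  let Y w i := `|\sum_j z j * A i j w| `^ p in
  (P [set w | (0 <= \sum_i (`|Y w i - t| + (2 * rho - 1) * t + dl))%R] <=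
     (th ^+ m)%:E)%E /\
  (P [set w | (0 <= \sum_i (Y w i - k))%R] <= (th ^+ m)%:E)%E].
Proof.
have [th1 /andP[th10 th11] T1] := gauss1_tail_bound mf1 f1_bound f1_neg.
have [th2 /andP[th20 th21] T2] := gauss1_tail_bound mf2 f2_bound f2_neg.
(* The [2^-1] makes the common rate positive, so that its logarithm can be used as a decay rate. *)
exists tau, del, K, (Num.max (Num.max th1 th2) 2^-1); split => //.
  by rewrite lt_max invr_gt0 ltr0n orbT !gt_max th11 th21 invf_lt1 ?ltr1n.
move=> d Omega P m n A z iidA z1 Y; split.
  apply: (le_trans (T1 _ _ _ _ _ _ _ iidA z1)).
  by rewrite lee_fin lerXn2r// ?nnegrE ?le_max ?lexx ?th10.
apply: (le_trans (T2 _ _ _ _ _ _ _ iidA z1)).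
by rewrite lee_fin lerXn2r// ?nnegrE ?le_max ?lexx ?th20 ?orbT.
Qed.
End UniformTails.

(** * Choice of the constants and conclusion *)

Lemma exists_small_radius (R : realType) (p K del : R) : 0 < p -> 0 < K -> 0 < del ->
  exists2 eps : R, 0 < eps & eps `^ p <= 2^-1 /\ eps `^ p * (2 * K) < del.
Proof.
(* Both conditions concern [eps ^ p] only, so [eps] is the [p]-th root of [t]; the 4 yields
   [2 K t <= del / 2], hence a strict inequality. *)
move=> p0 K0 del0; pose t := Num.min 2^-1 (del / (4 * K)).
have t0 : 0 < t by rewrite lt_min invr_gt0 ltr0n divr_gt0// mulr_gt0.
exists (t `^ p^-1); first exact: powR_gt0.
rewrite -powRrM mulVf ?gt_eqF// powRr1 ?(ltW t0)//; split.
  by rewrite ge_min lexx.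
have tK : t * (4 * K) <= del.
  by rewrite -ler_pdivlMr ?mulr_gt0// ge_min lexx orbT.
by lra.
Qed.

Unset Implicit Arguments.

Theorem theorem2 (R : realType) (p rho : R) (hp0 : 0 < p) (hp1 : p <= 1)
    (hrho : rho < rho_star p) :
  exists c4 c5 : R, 0 < c4 /\ 0 < c5 /\
  exists n0 : nat, forall n m : nat, (n0 <= n)%N -> c4 * n%:R <= m%:R ->
  forall (d : measure_display) (Omega : measurableType d)
    (P : probability Omega R) (A : 'I_m -> 'I_n -> {RV P >-> R}),
  iid_std_normal A ->
  exists E : set Omega,
    measurable E /\
    (forall w, E w -> lp_corrects p rho (sample_mx A w)) /\
    ((1 - expR (- (c5 * n%:R)))%:E <= P E)%E.
Proof.
have [tau [del [K [th [tau0 del0 K0 /andP[th0 th1] tails]]]]] :=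
  uniform_tails hp0 hp1 hrho.
have [eps eps0 [epsp epsK]] := exists_small_radius hp0 K0 del0.
have [D D0 net] := sphere_net eps0.
pose c := - ln th; have c0 : 0 < c by rewrite oppr_gt0 ln_lt0// th0.
(* For [n >= 1], [2 * D ^ n <= (2 * (D + 1)) ^ n = expR (C * n)]; [D + 1] replaces [D] so that
   [C > 0]. *)
pose C := ln (2 * (D + 1)).
have C0 : 0 < C by rewrite ln_gt0//; lra.
(* The failure probability is at most [expR (C * n - c * m)], and [c * m >= (C + 1) * n] turns this
   into [expR (- n)]. *)
exists ((C + 1) / c), 1; split; first by rewrite divr_gt0// addr_gt0.
split => //; exists 1%N => n m n0 mn d Omega P A iidA.
have [N [sN N1 Nnet]] := net n.
have n0R : 1 <= n%:R :> R by rewrite ler1n.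
have m0 : 0 < m%:R :> R.
  by apply: lt_le_trans mn; rewrite mulr_gt0 ?(lt_le_trans ltr01 n0R)// divr_gt0// addr_gt0.
pose Y (v : 'cV[R]_n) w i := `|\sum_j v j 0 * A i j w| `^ p.
pose S1 v w := \sum_i (`|Y v w i - tau| + (2 * rho - 1) * tau + del).
pose S2 v w := \sum_i (Y v w i - K).
have mY v i : measurable_fun setT (fun w => Y v w i).
  apply: (measurableT_comp (measurable_abs_powR p)).
  by apply: measurable_sum => j; exact: measurable_funM.
have mS1 v : measurable_fun setT (S1 v).
  apply: measurable_sum => i; apply: measurable_funD => //; apply: measurable_funD => //.
  by apply: measurableT_comp => //; exact: measurable_funB.
have mS2 v : measurable_fun setT (S2 v).
  by apply: measurable_sum => i; exact: measurable_funB.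
pose bad v := [set w | 0 <= S1 v w] `|` [set w | 0 <= S2 v w].
have mge (S : Omega -> R) : measurable_fun setT S -> measurable [set w | 0 <= S w].
  move=> mS; rewrite (_ : [set _ | _] = S @^-1` `[0, +oo[).
    exact: measurable_preimage.
  by apply/seteqP; split => w; rewrite /= in_itv/= andbT.
have mbad v : measurable (bad v) by apply: measurableU; exact: mge.
pose B := \big[setU/set0]_(v <- N) bad v.
have mB : measurable B by exact: bigsetU_measurable.
(* As the complement of finitely many measurable events, this set is measurable, and the set of all
   [w] for which correction holds need not be examined. *)
exists (~` B); split; first exact: measurableC.
split => [w Bw|].
  have good v : v \in N -> S1 v w < 0 /\ S2 v w < 0.
    move=> vN; have nbad : ~ bad v w.
      by move=> bw; apply: Bw; rewrite /B -bigcup_seq; exists v.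
    by split; rewrite ltNge; apply/negP => ?; apply: nbad; [left|right].
  have AvE v i : (sample_mx A w *m v) i 0 = \sum_j v j 0 * A i j w.
    by rewrite mxE; apply: eq_bigr => j _; rewrite mxE mulrC.
  have nE v : normpp p (sample_mx A w *m v) = \sum_i Y v w i.
    by apply: eq_bigr => i _; rewrite AvE.
  apply: (@gap_of_net R p hp0 hp1 m n (sample_mx A w) N eps (K * m%:R) (ltW eps0) epsp
    _ Nnet _ rho tau (del * m%:R)).
  - by rewrite mulr_ge0 ?ltW.
  - move=> v vN; have [_] := good v vN.
    rewrite /S2 big_split/= sumr_const card_ord mulNrn subr_lt0.
    rewrite -[K *+ m]mulr_natr => /ltW.
    by rewrite nE.
  - exact: ltW.
  - move=> v vN; have [+ _] := good v vN.
    rewrite /S1 big_split/= sumr_const card_ord -[del *+ m]mulr_natr => S1v.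
    under eq_bigr do rewrite AvE.
    by apply: ltW; rewrite -subr_lt0 opprK.
  (* Both sides carry the factor [m > 0], which cancels; this is why [eps] could be fixed
     beforehand. *)
  - by rewrite mulrA mulrA ltr_pM2r// -mulrA.
have PB : (P B <= (expR (- (1 * n%:R)))%:E)%E.
  apply: (@le_trans _ _ ((size N)%:R * (2 * th ^+ m))%:E).
    apply: probability_bigsetU_le => // v vN.
    have [T1 T2] := tails _ _ P m n A (fun j => v j 0) iidA (N1 v vN).
    rewrite mulr_natl mulr2n EFinD.
    apply: (@le_trans _ _ (P [set w | 0 <= S1 v w]%R + P [set w | 0 <= S2 v w]%R)%E).
      by apply: measureU2; exact: mge.
    exact: leeD.
  rewrite lee_fin.
  have thE : th ^+ m = expR (- (c * m%:R)).
    by rewrite /c mulNr opprK mulrC expRM_natl lnK// posrE.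
  apply: (@le_trans _ _ (D ^+ n * (2 * th ^+ m))).
    by rewrite ler_wpM2r// mulr_ge0// exprn_ge0// ltW.
  rewrite mulrA thE; apply: (@le_trans _ _ (expR (C * n%:R) * expR (- (c * m%:R)))).
    have -> : expR (C * n%:R) = (2 * (D + 1)) ^+ n.
      by rewrite mulrC expRM_natl lnK// posrE; lra.
    rewrite ler_wpM2r ?expR_ge0// exprMn mulrC; apply: ler_pM; rewrite ?exprn_ge0 ?(ltW D0)//.
      by rewrite -[leLHS]expr1 ler_eXn2l// ltr1n.
    by rewrite lerXn2r ?nnegrE ?(ltW D0)//; lra.
  rewrite -expRD ler_expR mul1r.
  move: mn; rewrite mulrAC ler_pdivrMr//; lra.
rewrite probability_setC// EFinB.
exact: leeB.
Qed.
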